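(* Let $0<s<1$, $\epsilon\in(0,1)$, and let $\Omega\subset\mathbb{R}^n$ be an open set (possibly unbounded and disconnected) such that there exists a constant $\bar C>0$ independent of $x$ with: for every $x\in\Omega$ the limit $\lim_{R\to+\infty}\frac{|B_R(x)\cap\Omega^c|}{|B_R(x)|}$ exists and is $\ge\bar C$. Suppose $u\in C^{2s+\epsilon,s+\epsilon}_{x,t,\mathrm{loc}}(\Omega\times\mathbb{R})\cap\mathcal{L}(\mathbb{R}^n\times\mathbb{R})$ is upper semi-continuous up to the boundary $\partial\Omega$, bounded from above in $\Omega\times\mathbb{R}$, and satisfies $$(\partial_t-\Delta)^s u(x,t)\le 0\ \text{at the points of }\Omega\times\mathbb{R}\text{ where }u(x,t)>0,\qquad u\le0\ \text{in }\Omega^c\times\mathbb{R}.$$ Then $u\le 0$ in $\Omega\times\mathbb{R}$.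
   Context: For $0<s<1$, $(\partial_t-\Delta)^s u(x,t):=C_{n,s}\int_{-\infty}^{t}\int_{\mathbb{R}^n}\frac{u(x,t)-u(y,\tau)}{(t-\tau)^{\frac n2+1+s}}e^{-\frac{|x-y|^2}{4(t-\tau)}}\,dy\,d\tau$ (principal value in $y$), with $C_{n,s}=\frac{1}{(4\pi)^{n/2}|\Gamma(-s)|}$. $\mathcal{L}(\mathbb{R}^n\times\mathbb{R})$ is the set of $u\in L^1_{\mathrm{loc}}$ with $\int_{-\infty}^t\int_{\mathbb{R}^n}\frac{|u(x,\tau)|e^{-\frac{|x|^2}{4(t-\tau)}}}{1+(t-\tau)^{\frac n2+1+s}}dx\,d\tau<\infty$ for all $t$. Parabolic Hölder space $C^{2\alpha,\alpha}_{x,t}$: for $0<\alpha\le\frac12$, $|u(x,t)-u(y,\tau)|\le C(|x-y|+|t-\tau|^{1/2})^{2\alpha}$; for $\frac12<\alpha\le1$, $u$ is $\alpha$-Hölder in $t$ uniformly in $x$ and $\nabla_xu$ is $(2\alpha-1)$-Hölder in $x$ uniformly in $t$ and $(\alpha-\frac12)$-Hölder in $t$ uniformly in $x$; for $\alpha>1$, $\partial_tu,D^2_xu\in C^{2\alpha-2,\alpha-1}_{x,t}$; ''loc'' means on compact subsets. $|\cdot|$ is Lebesgue measure, $\Omega^c=\mathbb{R}^n\setminus\Omega$. *)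

(* Defs.v *)
From HB Require Import structures.
From mathcomp Require Import all_boot all_order all_algebra.
From mathcomp Require Import all_classical all_reals all_analysis.
Set Implicit Arguments. Unset Strict Implicit. Unset Printing Implicit Defensive.
Import Order.TTheory GRing.Theory Num.Theory.
Import numFieldNormedType.Exports.
Local Open Scope classical_set_scope.
Local Open Scope ring_scope.

Section Defs.
Variable R : realType.

Definition enorm n (x : 'rV[R]_n) : R := Num.sqrt (\sum_(i < n) x ord0 i ^+ 2).

Definition eball n (x : 'rV[R]_n) (r : R) : set 'rV[R]_n :=
  [set y | enorm (y - x) < r].

Definition rcons0 n (a : R) (v : 'rV[R]_n) : 'rV[R]_n.+1 :=
  \row_(i < n.+1) match unlift ord0 i with Some j => v ord0 j | None => a end.

(* Lebesgue integral over R^n, as the iterated integral dy_1 ... dy_n *)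
Fixpoint iint n : ('rV[R]_n -> \bar R) -> \bar R :=
  match n with
  | 0 => fun f => f 0
  | n'.+1 => fun f =>
      (\int[@lebesgue_measure R]_(a in setT) @iint n' (fun v => f (rcons0 a v)))%E
  end.

Definition lebn n (A : set 'rV[R]_n) : \bar R := iint (fun y => (\1_A y)%:E).

Definition stint n (f : 'rV[R]_n -> R -> \bar R) (D : set R) : \bar R :=
  (\int[@lebesgue_measure R]_(t in D) iint (fun y => f y t))%E.

Definition borel_st n (A : set ('rV[R]_n * R)) : Prop :=
  <<s [set U : set ('rV[R]_n * R) | open U] >> A.

Definition leb_measurable n (u : 'rV[R]_n -> R -> R) : Prop :=
  exists g : 'rV[R]_n -> R -> R,
    (forall B : set R, open B -> borel_st ((fun p => g p.1 p.2) @^-1` B)) /\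
    exists N : set ('rV[R]_n * R), borel_st N /\
      stint (fun y t => (\1_N (y, t))%:E) setT = 0%E /\
      (forall y t, u y t <> g y t -> N (y, t)).

Definition L1loc n (u : 'rV[R]_n -> R -> R) : Prop :=
  leb_measurable u /\
  forall r : R, 0 < r ->
    (stint (fun y t => (\1_(eball 0 r) y * `|u y t|)%:E) `[(- r)%R, r] < +oo)%E.

Definition calL n (s : R) (u : 'rV[R]_n -> R -> R) : Prop :=
  L1loc u /\
  forall t : R,
    (stint (fun x tau => (`|u x tau| * expR (- (enorm x ^+ 2) / (4 * (t - tau)))
                / (1 + (t - tau) `^ (n%:R / 2 + 1 + s)))%:E) `]-oo, t[ < +oo)%E.

Definition gammaR (z : R) : R :=
  fine (\int[@lebesgue_measure R]_(x in `]0%R, +oo[) (x `^ (z - 1) * expR (- x))%:E)%E.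

(* C_{n,s} = 1 / ((4 pi)^{n/2} |Gamma(-s)|), with |Gamma(-s)| = Gamma(1-s)/s for 0<s<1 *)
Definition Cns (n : nat) (s : R) : R :=
  1 / ((4 * pi) `^ (n%:R / 2) * (gammaR (1 - s) / s)).

Definition frac_heat n (s : R) (u : 'rV[R]_n -> R -> R) (x : 'rV[R]_n) (t : R) : R :=
  Cns n s * fine (\int[@lebesgue_measure R]_(tau in `]-oo, t[)
     iint (fun y => ((u x t - u y tau) / (t - tau) `^ (n%:R / 2 + 1 + s)
                      * expR (- (enorm (x - y) ^+ 2) / (4 * (t - tau))))%:E))%E.

Definition pdx n (u : 'rV[R]_n -> R -> R) (i : 'I_n) : 'rV[R]_n -> R -> R :=
  fun x t => 'D_(delta_mx ord0 i) (fun y => u y t) x.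
Definition pdt n (u : 'rV[R]_n -> R -> R) : 'rV[R]_n -> R -> R :=
  fun x t => 'D_1 (fun tau => u x tau) t.

Definition hol_low n (b : R) (f : 'rV[R]_n -> R -> R) (K : set ('rV[R]_n * R)) :=
  exists C : R, forall x y t tau, K (x, t) -> K (y, tau) ->
    `|f x t - f y tau| <= C * (enorm (x - y) + Num.sqrt `|t - tau|) `^ (2 * b).

Definition hol_mid n (a : R) (u : 'rV[R]_n -> R -> R) (K : set ('rV[R]_n * R)) :=
  (forall x t, K (x, t) -> differentiable (fun y => u y t) x) /\
  exists C : R,
    (forall x t tau, K (x, t) -> K (x, tau) -> `|u x t - u x tau| <= C * `|t - tau| `^ a) /\
    forall i : 'I_n,
      (forall x y t, K (x, t) -> K (y, t) ->
         `|pdx u i x t - pdx u i y t| <= C * enorm (x - y) `^ (2 * a - 1)) /\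
      (forall x t tau, K (x, t) -> K (x, tau) ->
         `|pdx u i x t - pdx u i x tau| <= C * `|t - tau| `^ (a - 1 / 2)).

Definition hol_high n (a : R) (u : 'rV[R]_n -> R -> R) (K : set ('rV[R]_n * R)) :=
  (forall x t, K (x, t) ->
     [/\ differentiable (fun y => u y t) x, derivable (fun tau => u x tau) t 1
       & forall i, differentiable (fun y => pdx u i y t) x]) /\
  hol_low (a - 1) (pdt u) K /\
  forall i j : 'I_n, hol_low (a - 1) (pdx (pdx u i) j) K.

(* u in C^{2a,a}_{x,t,loc}(Om x R), 0 < a <= 3/2 *)
Definition parabolic_holder_loc n (a : R) (Om : set 'rV[R]_n) (u : 'rV[R]_n -> R -> R) :=
  forall K : set ('rV[R]_n * R), compact K -> K `<=` Om `*` setT ->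
    if a <= 1 / 2 then hol_low a u K
    else if a <= 1 then hol_mid a u K
    else hol_high a u K.

Definition usc_up_to_boundary n (Om : set 'rV[R]_n) (u : 'rV[R]_n -> R -> R) :=
  forall x t, closure Om x -> forall e : R, 0 < e ->
    exists2 d : R, 0 < d & forall y tau, closure Om y -> enorm (y - x) < d ->
      `|tau - t| < d -> u y tau < u x t + e.

Definition ext_ratio n (Om : set 'rV[R]_n) (x : 'rV[R]_n) (r : R) : R :=
  fine (lebn (eball x r `&` ~` Om)) / fine (lebn (eball x r)).

End Defs.

(* Main.v *)
(** Let [A > 0] be the supremum of [u].  Take [(x0, t0)] with [u x0 t0 > A - ep]
    and a radius [r] at which the exterior of [Om] fills a fixed proportion of
    the ball [B_r(x0)]; put [rho = r^2].  Adding to [u] the concave paraboloid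
    [ep * (1 - |y - x0|^2 / rho - (tau - t0)^2 / rho^2)] produces a maximum that is
    attained at some [(x, t)] with [x] in [Om], by upper semicontinuity.  There
    [u x t - u y tau] is at least [ep] times the increment of the paraboloid, and
    gains a further [A / 2] outside [Om].  By parabolic scaling the first
    contribution to the fractional heat operator is at least [- C ep rho^-s]
    (the linear part cancels by oddness) and the second at least [c A rho^-s], with
    [c], [C] independent of [x0], [t0] and [rho]; for small [ep] the operator is
    positive at [(x, t)], a contradiction. *)
Require Import Defs.
From HB Require Import structures.
From mathcomp Require Import all_boot all_order all_algebra.
From mathcomp Require Import all_classical all_reals all_analysis.
From mathcomp Require Import measurable_realfun ring lra.
Import Order.TTheory GRing.Theory Num.Theory.
Import numFieldNormedType.Exports.
Local Open Scope classical_set_scope.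
Local Open Scope ring_scope.
Set Implicit Arguments.
Unset Strict Implicit.
Unset Printing Implicit Defensive.

(** Two obstacles shape the argument. First, [x0] is chosen after [ep], and [r] after [x0]: the
    density of the exterior is only asserted in the limit, with no rate uniform in [x0]. Gain and
    loss must therefore carry the same power of [rho], so that [ep] can be fixed from [n], [s], [A]
    and the density constant alone. Second, [frac_heat] takes [fine] of an iterated integral, which
    turns an infinite value into 0, and [u] is only almost everywhere equal to a Borel function.
    Positivity of the integral contradicts the hypothesis only together with its finiteness, and
    this is where Hoelder regularity and [calL] enter. The bounds from above and below have one
    shape: a linear function times a Gaussian, a function of the time lag times a wider Gaussian,
    and a nonnegative term. Integrands are compared pointwise, which needs no measurability;
    additivity is only used for these comparison functions. No principal value has to be taken,
    because the integration in [y] comes first and removes the linear term at each lag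
    separately. *)

(** * Integrals of possibly nonmeasurable functions *)

Section integral_without_measurability.
Local Open Scope ereal_scope.
Context d (T : measurableType d) (R : realType) (mu : {measure set T -> \bar R}).
Implicit Types (f g : T -> \bar R) (D Z : set T).

(** The integral is a difference of two suprema over simple functions, taken below the positive and
    the negative part. Enlarging the function enlarges the first family and shrinks the second,
    whether or not it is measurable. *)
Lemma le_integral_nomeas D f g : (forall x, D x -> f x <= g x) ->
  \int[mu]_(x in D) f x <= \int[mu]_(x in D) g x.
Proof.
move=> fg.
have fgD x : (f \_ D) x <= (g \_ D) x.
  by rewrite /patch; case: ifPn => // /set_mem /fg.
rewrite /integral; apply: leeB; apply: le_ereal_sup => _ /= [h hf <-];
  exists h => // x; apply: le_trans (hf x) _.
- by rewrite !funeposE ge_max !le_max fgD lexx orbT.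
- by rewrite !funenegE ge_max !le_max leeN2 fgD lexx orbT.
Qed.

Lemma ge0_subset_integral_nomeas D D' f : D `<=` D' ->
  (forall x, D' x -> 0 <= f x) ->
  \int[mu]_(x in D) f x <= \int[mu]_(x in D') f x.
Proof.
move=> DD' f0; rewrite (integral_mkcond D) (integral_mkcond D').
apply: le_integral_nomeas => x _; rewrite /patch.
have [/set_mem Dx|_] := boolP (x \in D); first by rewrite mem_set//; exact: DD'.
by case: ifPn => // /set_mem /f0.
Qed.

Import HBNNSimple.

Let le_nnintegral_ae Z f g : measurable Z -> mu Z = 0 ->
  (forall x, 0 <= g x) -> (forall x, ~ Z x -> f x <= g x) ->
  ereal_sup [set sintegral mu h |
     h in [set h : {nnsfun T >-> R} | forall x, (h x)%:E <= f x]] <=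
  ereal_sup [set sintegral mu h |
     h in [set h : {nnsfun T >-> R} | forall x, (h x)%:E <= g x]].
Proof.
move=> mZ Z0 g0 fg; apply: ge_ereal_sup => _ /= [h hf <-].
apply: ereal_sup_ubound => /=; exists (proj_nnsfun h (measurableC mZ)).
  move=> x; rewrite -mrestrict /patch.
  by case: ifPn => // /set_mem /fg; exact: le_trans.
rewrite -!integralT_nnsfun; apply: ge0_ae_eq_integral => //.
- exact/measurable_EFinP.
- exact/measurable_EFinP.
- by move=> x _; rewrite lee_fin.
- by move=> x _; rewrite lee_fin.
- exists Z; split => // x /=; apply: contra_notP => nZx _.
  by rewrite /= mindicE mem_set// mulr1.
Qed.

(* The integral is a supremum over simple functions, so cutting these off on
   [Z] proves the claim even for nonmeasurable [f] and [g]. *)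
Lemma eq_integral_off_null D Z f g : measurable Z -> mu Z = 0 ->
  (forall x, D x -> ~ Z x -> f x = g x) ->
  \int[mu]_(x in D) f x = \int[mu]_(x in D) g x.
Proof.
move=> mZ Z0 fg.
have fgD x : ~ Z x -> (f \_ D) x = (g \_ D) x.
  by move=> nZ; rewrite /patch; case: ifPn => // /set_mem /fg; exact.
rewrite /integral; congr (_ - _); apply/eqP; rewrite eq_le; apply/andP; split;
  apply: (le_nnintegral_ae mZ Z0) => x.
all: try by rewrite !(funeposE,funenegE) le_max lexx orbT.
all: by move=> /fgD; rewrite !(funeposE,funenegE) => ->.
Qed.

(** The integral of [g] may be infinite. In that case the positive part of [f + g] also has infinite
    integral, since [g] is at most this positive part plus [|f|], while the negative part is at most
    [|f|]; so the indeterminate difference does not occur. *)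
Lemma integralD_ge0r D f g : measurable D -> mu.-integrable D f ->
  measurable_fun D g -> (forall x, D x -> 0 <= g x) ->
  \int[mu]_(x in D) (f x + g x) = \int[mu]_(x in D) f x + \int[mu]_(x in D) g x.
Proof.
move=> mD intf mg g0.
have mf := measurable_int mu intf.
have [goo|] := eqVneq (\int[mu]_(x in D) g x) +oo; last first.
  rewrite -ltey => gfin; apply: integralD => //; apply/integrableP; split => //.
  rewrite (eq_integral g)// => x /set_mem /g0 gx0; by rewrite gee0_abs.
have ffin := integrable_fin_num mD intf.
rewrite goo addey; last by rewrite -ltNye; move: ffin; rewrite fin_numElt => /andP[].
have mfg : measurable_fun D (fun x => f x + g x) by exact: emeasurable_funD.
have absf_fin := integrable_fin_num mD (integrable_abse intf).
have posE : \int[mu]_(x in D) ((fun x => f x + g x)^\+ x) = +oo.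
  apply/eqP; rewrite -leye_eq.
  have : \int[mu]_(x in D) g x <=
      \int[mu]_(x in D) ((fun x => f x + g x)^\+ x + `|f x|).
    apply: le_integral_nomeas => x /g0; rewrite funeposE.
    case: (f x) (g x) => [a| |] [b| |] //=; rewrite ?leey// => b0.
      rewrite -EFinD -EFin_max -EFinD lee_fin.
      have : (a + b <= Num.max (a + b) 0)%R by rewrite le_max lexx.
      by have := ler_norm (- a)%R; rewrite normrN; lra.
    - by rewrite addNye max_r ?leNye// add0e leey.
    - by rewrite addNye max_r ?leNye// add0e leey.
  rewrite ge0_integralD//; last 2 first.
    - exact: measurable_funepos.
    - exact: measurableT_comp.
  rewrite goo; move: absf_fin; rewrite /comp/=.
  by case: (\int[mu]_(x in D) `|f x|) => //= a _; case: integral.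
rewrite integralE posE.
suff : \int[mu]_(x in D) (fun x => f x + g x)^\- x < +oo.
  by case: integral.
apply: le_lt_trans (_ : \int[mu]_(x in D) `|f x| < +oo); last first.
  by move: absf_fin; rewrite fin_numElt => /andP[].
apply: le_integral_nomeas => x /g0; rewrite funenegE.
case: (f x) (g x) => [a| |] [b| |] //=; rewrite ?leey// => b0.
  rewrite -EFin_max lee_fin ge_max normr_ge0 andbT.
  by have := ler_norm (-a); rewrite normrN; move: b0; rewrite lee_fin; lra.
by rewrite max_r// ?leNye// lee_fin.
Qed.

End integral_without_measurability.

(** * The iterated integral over R^n *)

Section iterated_integral.
Local Open Scope ereal_scope.
Context {R : realType}.
Notation mu := (@lebesgue_measure R).

Lemma le_iint n (f g : 'rV[R]_n -> \bar R) : (forall y, f y <= g y) ->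
  iint f <= iint g.
Proof.
elim: n f g => [f g fg|n ih f g fg]; first exact: fg.
by apply: le_integral_nomeas => a _; apply: ih => v; exact: fg.
Qed.

Lemma eq_iint n (f g : 'rV[R]_n -> \bar R) : f =1 g -> iint f = iint g.
Proof. by move=> /funext ->. Qed.

Lemma iint0 n : iint (fun _ : 'rV[R]_n => 0) = 0.
Proof.
elim: n => [//|n ih]; rewrite -[RHS](integral0 mu setT).
by apply: eq_integral => a _; exact: ih.
Qed.

Lemma iint_ge0 n (f : 'rV[R]_n -> \bar R) : (forall y, 0 <= f y) -> 0 <= iint f.
Proof. by move=> f0; rewrite -(iint0 n); exact: le_iint. Qed.

Definition coord_measurable d (S : measurableType d) n (b : S -> 'rV[R]_n) :=
  forall i, measurable_fun setT (fun z => b z ord0 i).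

(* Joint measurability on [T * R^n], tested on all measurable
   parametrizations; this spares a sigma-algebra on row vectors. *)
Definition jmeas d (T : measurableType d) n (f : T -> 'rV[R]_n -> \bar R) :=
  forall d' (S : measurableType d') (a : S -> T) (b : S -> 'rV[R]_n),
    measurable_fun setT a -> coord_measurable b ->
    measurable_fun setT (fun z => f (a z) (b z)).

Definition cmeas n (f : 'rV[R]_n -> \bar R) :=
  forall d' (S : measurableType d') (b : S -> 'rV[R]_n),
    coord_measurable b -> measurable_fun setT (f \o b).

Lemma coord_measurable_rcons0 d (S : measurableType d) n (a : S -> R)
    (b : S -> 'rV[R]_n) : measurable_fun setT a -> coord_measurable b ->
  coord_measurable (fun z => rcons0 (a z) (b z)).
Proof.
move=> ma mb i.
have E z : rcons0 (a z) (b z) ord0 i =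
    match unlift ord0 i with Some j => b z ord0 j | None => a z end by rewrite mxE.
rewrite (_ : (fun z => _) = fun z => match unlift ord0 i with
  Some j => b z ord0 j | None => a z end); last exact/funext.
by case: (unlift _ _) => [j|//]; exact: mb.
Qed.

(** The induction has to range over all parameter spaces: the first coordinate of [y] joins the
    parameter, turning [T] into [T * R], and Tonelli's theorem then integrates it out again. *)
Lemma jmeas_iint d (T : measurableType d) n (f : T -> 'rV[R]_n -> \bar R) :
  jmeas f -> (forall z y, 0 <= f z y) ->
  measurable_fun setT (fun z => iint (f z)).
Proof.
elim: n d T f => [d T f mf f0|n ih d T f mf f0].
  rewrite [X in measurable_fun _ X](_ : _ = fun z => f z 0%R)//.
  by apply: mf => // -[].
pose g (za : T * R) v := f za.1 (rcons0 za.2 v).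
have mg : measurable_fun setT (fun za => iint (g za)).
  apply: ih => [|? ?]; last exact: f0.
  move=> d' S a b ma mb; apply: mf; first exact: measurableT_comp.
  by apply: coord_measurable_rcons0 => //; exact: measurableT_comp.
apply: (@measurable_fun_fubini_tonelli_F _ _ _ _ _ mu _ mg).
by move=> ?; apply: iint_ge0 => ?; exact: f0.
Qed.

Lemma jmeas_cmeas d (T : measurableType d) n (f : T -> 'rV[R]_n -> \bar R) z :
  jmeas f -> cmeas (f z).
Proof. by move=> mf d' S b mb; apply: mf. Qed.

Lemma cmeas_jmeas_rcons0 n (f : 'rV[R]_n.+1 -> \bar R) : cmeas f ->
  jmeas (fun a v => f (rcons0 a v)).
Proof.
move=> mf d' S a b ma mb; apply: (mf _ _ (fun z => rcons0 (a z) (b z))).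
exact: coord_measurable_rcons0.
Qed.

Lemma cmeas_rcons0 n (f : 'rV[R]_n.+1 -> \bar R) a : cmeas f ->
  cmeas (fun v => f (rcons0 a v)).
Proof. by move=> /cmeas_jmeas_rcons0/(jmeas_cmeas a). Qed.

Lemma measurable_iint_rcons0 n (f : 'rV[R]_n.+1 -> \bar R) : cmeas f ->
  (forall y, 0 <= f y) ->
  measurable_fun setT (fun a => iint (fun v => f (rcons0 a v))).
Proof. by move=> mf f0; apply: jmeas_iint => //; exact: cmeas_jmeas_rcons0. Qed.

(** To be used with [h] the indicator of a null set. Since [iint h] vanishes, so does the inner
    integral for almost every first coordinate; the induction applies to these slices, and
    [eq_integral_off_null] discards the others without asking anything of [f] and [g]. *)
Lemma eq_iint_off_null n (h f g : 'rV[R]_n -> \bar R) : cmeas h ->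
  (forall y, 0 <= h y) -> iint h = 0 ->
  (forall y, h y = 0 -> f y = g y) -> iint f = iint g.
Proof.
elim: n h f g => [h f g _ _ h0 fg|n ih h f g mh h0 ih0 fg]; first exact: fg.
pose H a := iint (fun v => h (rcons0 a v)).
have mH : measurable_fun setT H by exact: measurable_iint_rcons0.
have H0 a : 0 <= H a by apply: iint_ge0 => v; exact: h0.
have := (ae_eq_integral_abs mu measurableT mH).1.
have -> : \int[mu]_a `|H a| = 0.
  by rewrite -[RHS]ih0; apply: eq_integral => a _; rewrite gee0_abs.
move=> /(_ erefl) [Z [mZ Z0 HZ]].
apply: (eq_integral_off_null mZ Z0) => a _ nZ.
apply: (ih (fun v => h (rcons0 a v))) => //; first exact: cmeas_rcons0.
- by apply: contrapT => Ha; apply/nZ/HZ => /= /(_ I).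
- by move=> v; exact: fg.
Qed.

(* Every slice is integrable, not merely almost every one; no almost-everywhere
   reasoning is then needed for additivity. *)
Fixpoint slice_integrable n : ('rV[R]_n -> \bar R) -> Prop :=
  match n with
  | 0 => fun f => f 0%R \is a fin_num
  | n'.+1 => fun f => (forall a, @slice_integrable n' (fun v => f (rcons0 a v))) /\
      mu.-integrable setT (fun a => iint (fun v => f (rcons0 a v)))
  end.

Lemma iintD_ge0r n (f g : 'rV[R]_n -> \bar R) : slice_integrable f ->
  cmeas g -> (forall y, 0 <= g y) ->
  iint (fun y => f y + g y) = iint f + iint g.
Proof.
elim: n f g => [//|n ih] f g [nf intf] mg g0.
rewrite /= -/iint -integralD_ge0r//.
- apply: eq_integral => a _; apply: (ih _ _ (nf a)) => //; exact: cmeas_rcons0.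
- exact: measurable_iint_rcons0.
- by move=> a _; apply: iint_ge0.
Qed.

Lemma iintD_slice n (f g : 'rV[R]_n -> \bar R) : slice_integrable f ->
  slice_integrable g -> iint (fun y => f y + g y) = iint f + iint g.
Proof.
elim: n f g => [//|n ih] f g [nf intf] [ng intg].
rewrite /= -/iint -integralD//; apply: eq_integral => a _.
exact: (ih _ _ (nf a) (ng a)).
Qed.

Lemma slice_integrableD n (f g : 'rV[R]_n -> \bar R) : slice_integrable f ->
  slice_integrable g -> slice_integrable (fun y => f y + g y).
Proof.
elim: n f g => [f g /= ff gf|n ih f g [nf intf] [ng intg]].
  by rewrite fin_numD ff.
split => [a|]; first exact: (ih _ _ (nf a) (ng a)).
rewrite (_ : (fun a => _) = (fun a => iint (fun v => f (rcons0 a v))) \+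
  (fun a => iint (fun v => g (rcons0 a v)))); first exact: integrableD.
by apply/funext => a; exact: (iintD_slice (nf a) (ng a)).
Qed.

Lemma iintZl_slice n (f : 'rV[R]_n -> \bar R) (k : R) : slice_integrable f ->
  slice_integrable (fun y => k%:E * f y) /\
  iint (fun y => k%:E * f y) = k%:E * iint f.
Proof.
elim: n f => [f /= ff|n ih f [nf intf]]; first by rewrite fin_numM.
have E : (fun a => iint (fun v => k%:E * f (rcons0 a v))) =
    (fun a => k%:E * iint (fun v => f (rcons0 a v))).
  by apply/funext => a; exact: (ih _ (nf a)).2.
split=> /=; last by rewrite -/iint E integralZl.
by split => [a|]; [exact: (ih _ (nf a)).1|rewrite E; exact: integrableZl].
Qed.

Lemma iintZl n (f : 'rV[R]_n -> \bar R) (k : R) : (0 <= k)%R -> cmeas f ->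
  (forall y, 0 <= f y) -> iint (fun y => k%:E * f y) = k%:E * iint f.
Proof.
move=> k0; elim: n f => [//|n ih f mf f0].
rewrite /= -/iint -ge0_integralZl//.
- by apply: eq_integral => a _; rewrite ih//; exact: cmeas_rcons0.
- exact: measurable_iint_rcons0.
- by move=> a _; exact: iint_ge0.
Qed.

(** Source of all explicit integrals below: a Gaussian, one coordinate times a Gaussian and the
    indicator of a cube are products of functions of one variable. *)
Lemma iint_prod n (f : 'I_n -> R -> R) :
  (forall i, mu.-integrable setT (EFin \o f i)) ->
  slice_integrable (fun y : 'rV[R]_n => (\prod_i f i (y ord0 i))%:E) /\
  iint (fun y : 'rV[R]_n => (\prod_i f i (y ord0 i))%:E) =
  (\prod_i fine (\int[mu]_a (f i a)%:E))%:E.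
Proof.
elim: n f => [f _|n ih f intf].
  by rewrite /= !big_ord0.
pose g := fun i : 'I_n => f (lift ord0 i).
have [gs gi] := ih g (fun i => intf _).
have Er a : (fun v : 'rV[R]_n => (\prod_i f i (rcons0 a v ord0 i))%:E) =
    (fun v => (f ord0 a)%:E * (\prod_i g i (v ord0 i))%:E).
  apply/funext => v; rewrite big_ord_recl -EFinM; congr (_ * _)%:E.
    by rewrite mxE unlift_none.
  by apply: eq_bigr => i _; rewrite mxE liftK.
have Ei : (fun a => iint (fun v : 'rV[R]_n => (\prod_i f i (rcons0 a v ord0 i))%:E)) =
    (fun a => (\prod_i fine (\int[mu]_a (g i a)%:E))%:E * (f ord0 a)%:E).
  by apply/funext => a; rewrite Er (iintZl_slice _ gs).2 gi muleC.
split => /=.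
  split=> [a|]; first by rewrite Er; exact: (iintZl_slice _ gs).1.
  by rewrite Ei; exact/integrableZl/intf.
rewrite -/iint Ei integralZl//; last exact: intf.
rewrite big_ord_recl EFinM muleC fineK//.
by apply: integrable_fin_num => //; exact: intf.
Qed.

End iterated_integral.

(** * Borel sets of space-time and measurable parametrizations *)

Section measurability.
Context {R : realType}.

Let rat_approx (a e : R) : 0 < e -> exists q : rat, `|a - ratr q| < e.
Proof.
move=> e0; have : a - e < a + e by lra.
move=> /rat_in_itvoo[q]; rewrite in_itv/= => /andP[q1 q2]; exists q.
by rewrite ltr_distl; apply/andP; split; lra.
Qed.

(* An open set is the union of the countably many rational boxes it contains. *)
Lemma measurable_preimage_open d (S : measurableType d) n (b : S -> 'rV[R]_n)
    (a : S -> R) (U : set ('rV[R]_n * R)) : coord_measurable b ->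
  measurable_fun setT a -> open U -> measurable [set z | U (b z, a z)].
Proof.
move=> mb ma oU.
pose box (q : 'rV[rat]_n * rat * rat) : set ('rV[R]_n * R) :=
  [set p : 'rV[R]_n * R | `|p.2 - ratr q.1.2| < ratr q.2 /\
           forall i, `|p.1 ord0 i - ratr (q.1.1 ord0 i)| < ratr q.2].
pose F q := if `[< box q `<=` U >] then [set z | box q (b z, a z)] else set0.
have -> : [set z | U (b z, a z)] = \bigcup_q F q.
  apply/seteqP; split => [z Uz|z [q _]]; last first.
    by rewrite /F; case: asboolP => // bU /bU.
  have /nbhs_ballP[e /= e0 eU] := oU _ Uz.
  have [r0 [r0pos r0e]] : exists r : rat, 0 < ratr r :> R /\ ratr r < e / 2 :> R.
    have e2 : (0 : R) < e / 2 by rewrite divr_gt0.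
    move: (rat_in_itvoo e2) => [r]; rewrite in_itv/= => /andP[? ?].
    by exists r.
  have [q0 hq0] := rat_approx (a z) r0pos.
  have /choice[q hq] : forall i : 'I_n, exists q : rat,
      `|b z ord0 i - ratr q| < ratr r0 :> R by move=> i; exact: rat_approx.
  exists (\row_i q i, q0, r0) => //.
  have bz : box (\row_i q i, q0, r0) (b z, a z).
    by split => //= i; rewrite mxE.
  rewrite /F asboolT//= => -[y t] [/= ht hy].
  apply: eU; split => /=.
    split => // i j; rewrite (ord1 i) /ball/=.
    have := hy j; rewrite mxE => {}hy.
    rewrite (_ : b z ord0 j - _ = (b z ord0 j - ratr (q j)) - (y ord0 j - ratr (q j))); last by ring.
    by apply: le_lt_trans (ler_normB _ _) _; have := hq j; lra.
  rewrite /ball/= (_ : a z - t = (a z - ratr q0) - (t - ratr q0)); last by ring.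
  by apply: le_lt_trans (ler_normB _ _) _; lra.
apply: countable_bigcupT_measurable => [|q]; first exact: countableP.
rewrite /F; case: asboolP => // _.
have ball_meas (f : S -> R) c r : measurable_fun setT f ->
    measurable [set z | `|f z - c| < r].
  move=> mf; rewrite -[X in measurable X]setTI.
  have : measurable_fun setT (fun z => `|f z - c|).
    by apply: measurableT_comp => //; exact: measurable_funB.
  move=> /(_ measurableT `]-oo, r[%classic (measurable_itv _)).
  by congr (measurable (_ `&` _)); apply/seteqP; split => z /=; rewrite in_itv.
rewrite (_ : [set z | _] = [set z | `|a z - ratr q.1.2| < ratr q.2] `&`
    \bigcap_(i in setT) [set z | `|b z ord0 i - ratr (q.1.1 ord0 i)| < ratr q.2]).
  apply: measurableI; first exact: ball_meas.
  by apply: fin_bigcap_measurable => // i _; exact: ball_meas.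
apply/seteqP; split => z /= [? h]; split => // i; last exact: h.
by move=> _; exact: h.
Qed.

Lemma measurable_preimage_borel d (S : measurableType d) n (b : S -> 'rV[R]_n)
    (a : S -> R) (A : set ('rV[R]_n * R)) : coord_measurable b ->
  measurable_fun setT a -> borel_st A -> measurable [set z | A (b z, a z)].
Proof.
move=> mb ma.
have : <<s [set U : set ('rV[R]_n * R) | open U] >> `<=`
    [set A | measurable [set z | A (b z, a z)]].
  apply: smallest_sub => [|U oU]; last exact: measurable_preimage_open.
  split => [|B mB|F mF] /=.
  - by rewrite (_ : [set z | _] = set0)// -subset0.
  - rewrite (_ : [set z | _] = ~` [set z | B (b z, a z)]); first exact: measurableC.
    by apply/seteqP; split => z /=; [case|].
  - rewrite (_ : [set z | _] = \bigcup_k [set z | F k (b z, a z)]).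
      by apply: bigcup_measurable => k _; exact: mF.
    by apply/seteqP; split => z [k ? ?]; exists k.
by apply.
Qed.

Lemma jmeas_borel n (g : 'rV[R]_n -> R -> R) :
  (forall B : set R, open B -> borel_st ((fun p => g p.1 p.2) @^-1` B)) ->
  jmeas (fun t y => (g y t)%:E).
Proof.
move=> mg d S a b ma mb; apply/measurable_EFinP.
apply: (measurability _ (RGenOpens.measurableE R)) => _ [_ [x [y ->]] <-].
have oxy : open `]x, y[%classic by exact: interval_open.
by rewrite setTI; exact: (measurable_preimage_borel mb ma (mg _ oxy)).
Qed.

Lemma jmeas_indic n (N : set ('rV[R]_n * R)) : borel_st N ->
  jmeas (fun t y => (\1_N (y, t) : R)%:E).
Proof.
move=> bN d S a b ma mb; apply/measurable_EFinP.
rewrite (_ : (fun z => _) = \1_[set z | N (b z, a z)]).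
  exact/measurable_indic/measurable_preimage_borel.
by apply/funext => z; rewrite !indicE.
Qed.

Lemma cmeas_indic_open n (U : set 'rV[R]_n) : open U ->
  cmeas (fun y => (\1_(~` U) y : R)%:E).
Proof.
move=> oU d S b mb; apply/measurable_EFinP.
rewrite (_ : (fun z => _) = \1_(~` [set z | U (b z)])).
  apply: measurable_indic; apply: measurableC.
  have oU' : open ((@fst 'rV[R]_n R) @^-1` U).
    by apply: open_comp => // p _; exact: cvg_fst.
  have ma : measurable_fun setT ((fun=> 0) : S -> R) by [].
  exact: (measurable_preimage_open mb ma oU').
by apply/funext => z; rewrite /= !indicE.
Qed.

Lemma enorm_sqr n (x : 'rV[R]_n) : enorm x ^+ 2 = \sum_i x ord0 i ^+ 2.
Proof. by rewrite sqr_sqrtr// sumr_ge0// => i _; exact: sqr_ge0. Qed.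

Lemma enorm_ge0 n (x : 'rV[R]_n) : 0 <= enorm x.
Proof. exact: sqrtr_ge0. Qed.

Lemma coord_measurableB n d (S : measurableType d) (b : S -> 'rV[R]_n) x :
  coord_measurable b -> coord_measurable (fun z => x - b z).
Proof.
move=> mb i; rewrite (_ : (fun z => _) = fun z => x ord0 i - b z ord0 i).
  exact: measurable_funB.
by apply/funext => z; rewrite !mxE.
Qed.

Lemma measurable_enorm n d (S : measurableType d) (b : S -> 'rV[R]_n) :
  coord_measurable b -> measurable_fun setT (fun z => enorm (b z)).
Proof.
move=> mb.
have ms : measurable_fun setT (@Num.sqrt R).
  by apply: continuous_measurable_fun => x; exact: sqrt_continuous.
apply: (measurableT_comp ms); apply: measurable_sum => i.
exact: measurable_funX.
Qed.

End measurability.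

(** * Gaussian integrals and the cancellation of the linear term *)

Section gaussian.
Context {R : realType}.
Notation mu := (@lebesgue_measure R).

Definition reflect (c : R) : measurableTypeR R -> measurableTypeR R :=
  fun a => c - a.

Lemma measurable_reflect c : measurable_fun setT (reflect c).
Proof. by apply: measurable_funB. Qed.

HB.instance Definition _ c :=
  isMeasurableFun.Build _ _ _ _ (reflect c) (measurable_reflect c).

Lemma lebesgue_measure_reflect c (A : set R) : measurable A ->
  pushforward mu (reflect c) A = mu A.
Proof.
move=> mA; apply/esym/lebesgue_measure_unique => //= _ [[a b]] _ <-.
rewrite /pushforward (_ : _ @^-1` _ = `[(c - b)%R, (c - a)%R[%classic); last first.
  by apply/seteqP; split => x; rewrite /= !in_itv/= /reflect => /andP[? ?];
    apply/andP; split; lra.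
rewrite !lebesgue_measure_itv/= !lte_fin.
have -> : (c - b < c - a) = (a < b) by apply/idP/idP; lra.
by case: ifP => // _; rewrite -!EFinD; congr EFin; ring.
Qed.

Lemma ge0_integral_reflect c (D : set R) (f : R -> \bar R) : measurable D ->
  measurable_fun D f -> {in D, forall x, (0 <= f x)%E} ->
  (\int[mu]_(x in D) f x = \int[mu]_(x in reflect c @^-1` D) f (c - x)%R)%E.
Proof.
move=> mD mf f0; rewrite -(@ge0_integral_pushforward _ _ _ _ _ _
  (measurable_reflect c) mu D f)//.
by apply: eq_measure_integral => A mA _; exact/esym/lebesgue_measure_reflect.
Qed.

(** The function is odd about [c / 2], so reflection shows that the integral equals its own
    opposite; integrability makes it finite, hence zero. *)
Lemma odd_integral0 c (f : R -> R) : mu.-integrable setT (EFin \o f) ->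
  (forall a, f (c - a) = - f a) -> (\int[mu]_x (f x)%:E = 0)%E.
Proof.
move=> intf oddf.
have fin := integrable_fin_num measurableT intf.
suff E : (\int[mu]_x (f x)%:E = - \int[mu]_x (f x)%:E)%E.
  move: fin E; rewrite /comp; case: integral => //= r _ [] rE.
  by congr EFin; lra.
rewrite -[RHS]mulN1e -integralZl//.
have mf := measurable_int mu intf.
have intr : mu.-integrable (reflect c @^-1` setT) ((EFin \o f) \o reflect c).
  rewrite preimage_setT (_ : _ \o _ = (fun x => (-1)%:E * (f x)%:E)%E).
    exact: (integrableZl _ _ intf).
  by apply/funext => x /=; rewrite /reflect oddf -EFinM mulN1r.
transitivity (\int[pushforward mu (reflect c)]_x (f x)%:E)%E.
  by apply: eq_measure_integral => A mA _; exact/esym/lebesgue_measure_reflect.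
rewrite (integral_pushforward (measurable_reflect c) mf intr)//.
by rewrite preimage_setT; apply: eq_integral => x _; rewrite /= /reflect oddf mulN1e.
Qed.

Definition gauss1 (k x a : R) : R := expR (- (x - a) ^+ 2 / k).

(** Identifies [gauss1] with the unnormalized normal density of variance [k / 2], from which
    integrability and total mass are inherited. *)
Lemma gauss1_normal k x a : 0 < k -> gauss1 k x a = normal_fun x (Num.sqrt (k / 2)) a.
Proof.
move=> k0; rewrite /gauss1 /normal_fun sqr_sqrtr; last by rewrite divr_ge0// ltW.
by rewrite -mulr_natr divfK// -(sqrrN (x - a)) opprB.
Qed.

Lemma integrable_gauss1 k x : 0 < k ->
  mu.-integrable setT (EFin \o gauss1 k x).
Proof.
move=> k0; have s0 : Num.sqrt (k / 2) != 0 by rewrite gt_eqF// sqrtr_gt0 divr_gt0.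
rewrite (_ : EFin \o _ = (fun a => ((normal_peak (Num.sqrt (k / 2)))^-1)%:E *
   (normal_pdf x (Num.sqrt (k / 2)) a)%:E)%E).
  by apply: integrableZl => //; exact: integrable_normal_pdf.
apply/funext => a /=; rewrite gauss1_normal// normal_pdfE// -EFinM mulKf//.
by rewrite gt_eqF// normal_peak_gt0.
Qed.

Lemma integral_gauss1 k x : 0 < k ->
  (\int[mu]_a (gauss1 k x a)%:E = (Num.sqrt (pi * k))%:E)%E.
Proof.
move=> k0; have s0 : Num.sqrt (k / 2) != 0 by rewrite gt_eqF// sqrtr_gt0 divr_gt0.
have := integral_normal_pdf x (Num.sqrt (k / 2)).
rewrite normal_pdfE//; under eq_integral do rewrite -gauss1_normal// EFinM.
rewrite integralZl//; last exact: integrable_gauss1.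
have := integrable_fin_num measurableT (integrable_gauss1 x k0).
rewrite /comp; case: integral => //= r _ [] E.
congr EFin; have p0 := normal_peak_gt0 s0.
apply: (mulfI (lt0r_neq0 p0)); rewrite E /normal_peak sqr_sqrtr; last first.
  by rewrite divr_ge0// ltW.
rewrite (_ : k / 2 * pi *+ 2 = pi * k); last by rewrite -mulr_natr; field.
by rewrite mulVf// gt_eqF// sqrtr_gt0 mulr_gt0// pi_gt0.
Qed.

(** Half of the exponent pays for the linear factor. With [z = (x - a)^2 / (2 k)] the Gaussian is
    [exp(-z)^2], and [|a - x| <= 1 + 2 k z <= (1 + 2 k) exp z]; what remains is a Gaussian of width
    [2 * k]. *)
Lemma integrable_lin_gauss1 k x : 0 < k ->
  mu.-integrable setT (EFin \o (fun a => (a - x) * gauss1 k x a)).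
Proof.
move=> k0; have k20 : 0 < 2 * k by lra.
apply: (@le_integrable _ _ _ mu _ measurableT _
  (fun a => (1 + 2 * k)%:E * (gauss1 (2 * k) x a)%:E)%E).
- apply/measurable_EFinP; apply: measurable_funM; first exact: measurable_funB.
  by have /measurable_int/measurable_EFinP := integrable_gauss1 x k0.
- move=> a _ /=; rewrite lee_fin !normrM (ger0_norm (expR_ge0 _)).
  rewrite (@ger0_norm _ (1 + 2 * k)); last by lra.
  rewrite (ger0_norm (expR_ge0 _)) /gauss1.
  set z := (x - a) ^+ 2 / (2 * k).
  have -> : - (x - a) ^+ 2 / k = - z + - z by rewrite /z; field; lra.
  have -> : - (x - a) ^+ 2 / (2 * k) = - z by rewrite /z mulNr.
  rewrite expRD mulrA ler_wpM2r ?expR_ge0//.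
  rewrite expRN ler_pdivrMr ?expR_gt0//.
  have z0 : 0 <= z by rewrite divr_ge0 ?sqr_ge0// ltW.
  have hz : 1 + z <= expR z := expR_ge1Dx z.
  have h : `|a - x| ^+ 2 = 2 * k * z.
    by rewrite real_normK ?num_real// /z; field; lra.
  apply: (@le_trans _ _ ((1 + 2 * k) * (1 + z))); last by rewrite ler_wpM2l//; lra.
  have := normr_ge0 (a - x); move: (`|a - x|) h => w h w0.
  have : w <= 1 + w ^+ 2 by nra.
  rewrite h => wz; have : 0 <= k * z by rewrite mulr_ge0// ltW.
  by nra.
- by apply: integrableZl => //; exact: (integrable_gauss1 x k20).
Qed.

Lemma integral_lin_gauss1 k x : 0 < k ->
  (\int[mu]_a ((a - x) * gauss1 k x a)%:E = 0)%E.
Proof.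
move=> k0; apply: (@odd_integral0 (x + x)); first exact: integrable_lin_gauss1.
move=> a; rewrite /gauss1 (_ : x - (x + x - a) = - (x - a)); last by ring.
by rewrite sqrrN; ring.
Qed.

Definition gauss n (k : R) (x y : 'rV[R]_n) : R := expR (- enorm (x - y) ^+ 2 / k).

Lemma gauss_prod n k (x y : 'rV[R]_n) :
  gauss k x y = \prod_i gauss1 k (x ord0 i) (y ord0 i).
Proof.
rewrite /gauss enorm_sqr mulNr mulr_suml -sumrN expR_sum.
by apply: eq_bigr => i _; rewrite /gauss1 !mxE mulNr.
Qed.

Lemma iint_gauss n k (x : 'rV[R]_n) : 0 < k ->
  slice_integrable (fun y => (gauss k x y)%:E) /\
  iint (fun y => (gauss k x y)%:E) = (Num.sqrt (pi * k) ^+ n)%:E.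
Proof.
move=> k0.
have [h1 h2] := @iint_prod R n (fun i => gauss1 k (x ord0 i))
  (fun i => integrable_gauss1 _ k0).
rewrite (_ : (fun y => _) = (fun y : 'rV_n => (\prod_i gauss1 k (x ord0 i) (y ord0 i))%:E)).
  split => //; rewrite h2; congr EFin.
  under eq_bigr do rewrite integral_gauss1//=.
  by rewrite prodr_const card_ord.
by apply/funext => y; rewrite gauss_prod.
Qed.

Definition dotp n (c y : 'rV[R]_n) : R := \sum_i c ord0 i * y ord0 i.

(** By linearity one coordinate of [y - x] suffices, and then the integrand is a product with one
    odd factor. This is the cancellation that makes the singularity integrable when [2 * s >= 1]. *)
Lemma iint_lin_gauss n k (c x : 'rV[R]_n) : 0 < k ->
  slice_integrable (fun y => (dotp c (y - x) * gauss k x y)%:E) /\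
  iint (fun y => (dotp c (y - x) * gauss k x y)%:E) = 0%E.
Proof.
move=> k0.
rewrite (_ : (fun y => _) = (fun y : 'rV_n =>
  \sum_(i <- index_enum 'I_n) (c ord0 i)%:E * ((y ord0 i - x ord0 i) * gauss k x y)%:E)%E).
  elim: (index_enum _) => [|i r [ih1 ih2]].
    rewrite (_ : (fun y => _) = (fun y => 0%:E * (gauss k x y)%:E)%E).
      have [s _] := iint_gauss x k0; have [h1 h2] := iintZl_slice 0 s.
      by split=> //; rewrite h2 mul0e.
    by apply/funext => y; rewrite big_nil mul0e.
  have [s1 s2] : slice_integrable (fun y : 'rV[R]_n => ((y ord0 i - x ord0 i) * gauss k x y)%:E) /\
      iint (fun y : 'rV[R]_n => ((y ord0 i - x ord0 i) * gauss k x y)%:E) = 0%E.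
    (* The linear factor is attached to the Gaussian of the same coordinate, which makes the [i]-th
       factor of the product vanish on integration. *)
    pose f j a := if j == i then (a - x ord0 j) * gauss1 k (x ord0 j) a
      else gauss1 k (x ord0 j) a.
    have intf j : mu.-integrable setT (EFin \o f j).
      rewrite /f; case: eqP => _; first exact: integrable_lin_gauss1.
      exact: integrable_gauss1.
    have [h1 h2] := iint_prod intf.
    rewrite (_ : (fun y => _) = (fun y : 'rV_n => (\prod_j f j (y ord0 j))%:E)).
      split => //; rewrite h2 (bigD1 i)//= /f eqxx integral_lin_gauss1//=.
      by rewrite mul0r.
    apply/funext => y; congr EFin; rewrite gauss_prod (bigD1 i)//= [RHS](bigD1 i)//=.
    rewrite /f eqxx mulrA; congr (_ * _); apply: eq_bigr => j /negPf ji.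
    by rewrite ji.
  have [t1 t2] := iintZl_slice (c ord0 i) s1.
  rewrite (_ : (fun y => _) = (fun y : 'rV_n =>
    (c ord0 i)%:E * ((y ord0 i - x ord0 i) * gauss k x y)%:E +
    \sum_(j <- r) (c ord0 j)%:E * ((y ord0 j - x ord0 j) * gauss k x y)%:E)%E).
    split; first exact: slice_integrableD.
    by rewrite iintD_slice// t2 s2 ih2 mule0 adde0.
  by apply/funext => y; rewrite big_cons.
apply/funext => y; rewrite /dotp mulr_suml -sumEFin; apply: eq_bigr => i _.
by rewrite -EFinM !mxE mulrA.
Qed.

Lemma le_gauss n k k' (x y : 'rV[R]_n) : 0 < k -> k <= k' ->
  gauss k x y <= gauss k' x y.
Proof.
move=> k0 kk'; rewrite /gauss ler_expR !mulNr lerN2 ler_wpM2l ?sqr_ge0//.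
by rewrite lef_pV2// posrE; apply: lt_le_trans kk'.
Qed.

(** Two powers of the distance cost one power of the width, at the price of doubling the width:
    [z exp(-z) <= 1] for half of the exponent. *)
Lemma sqr_gauss_le n k (x y : 'rV[R]_n) : 0 < k ->
  enorm (x - y) ^+ 2 * gauss k x y <= 2 * k * gauss (2 * k) x y.
Proof.
move=> k0; rewrite /gauss; set z := enorm (x - y) ^+ 2 / (2 * k).
have -> : - enorm (x - y) ^+ 2 / k = - z + - z by rewrite /z; field; lra.
have -> : - enorm (x - y) ^+ 2 / (2 * k) = - z by rewrite /z mulNr.
rewrite expRD mulrA ler_wpM2r ?expR_ge0// expRN ler_pdivrMr ?expR_gt0//.
have -> : enorm (x - y) ^+ 2 = 2 * k * z by rewrite /z; field; lra.
rewrite ler_wpM2l//; first by lra.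
by apply: le_trans (expR_ge1Dx z); lra.
Qed.

Lemma measurable_gauss d (S : measurableType d) n (b : S -> 'rV[R]_n) (k : S -> R) x :
  coord_measurable b -> measurable_fun setT k ->
  measurable_fun setT (fun z => gauss (k z) x (b z)).
Proof.
move=> mb mk; apply: (measurableT_comp (@measurable_expR R)).
apply: measurable_funM.
  apply: measurableT_comp => //; apply: measurable_funX.
  exact/measurable_enorm/coord_measurableB.
(* The width is negative where the time lag is, so no sign is assumed. The power [-1] agrees with
   the inverse on nonnegative bases only, whence the two cases. *)
rewrite (_ : (fun z => _) = (fun z => if k z < 0 then - ((- k z) `^ (-1)) else k z `^ (-1))).
  apply: measurable_fun_ifT => //.
  - exact: measurable_fun_ltr.
  - apply: measurableT_comp => //.
    apply: (measurableT_comp (measurable_powR (-1))).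
    exact: measurableT_comp.
  - exact: (measurableT_comp (measurable_powR (-1))).
apply/funext => z; case: ltP => kz; last by rewrite powR_inv1.
by rewrite powR_inv1; [rewrite invrN opprK|rewrite oppr_ge0 ltW].
Qed.

End gaussian.

(** * Integrals in the time lag and the constant of the operator *)

Section power_integrals.
Context {R : realType}.
Notation mu := (@lebesgue_measure R).

Lemma measurable_powR_EFin (D : set R) (q : R) :
  measurable_fun D (fun x : R => (x `^ q)%:E).
Proof. by apply/measurable_EFinP; apply: measurable_funTS; exact: measurable_powR. Qed.

(** Monotone convergence reduces the improper integrals below to proper ones on compact intervals,
    bounded uniformly, with no limit to be computed. *)
Lemma ge0_integral_bigcup_le (F : (set R)^nat) (f : R -> \bar R) (B : \bar R) :
  nondecreasing_seq F -> (forall i, measurable (F i)) ->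
  measurable_fun setT f -> (forall x, (0 <= f x)%E) ->
  (forall i, (\int[mu]_(x in F i) f x <= B)%E) ->
  (\int[mu]_(x in \bigcup_i F i) f x <= B)%E.
Proof.
move=> ndF mF mf f0 FB.
have cv := ge0_nondecreasing_set_cvg_integral ndF mF
  (fun i => measurable_funTS mf) (fun i x _ => f0 x) (mu := mu).
rewrite -(cvg_lim _ cv)//; apply: lime_le; first by apply/cvg_ex; eexists; exact: cv.
exact: nearW.
Qed.

Lemma integral_powR (a b th : R) : 0 < a -> a < b -> th != 0 ->
  (\int[mu]_(x in `[a, b]) (x `^ (th - 1))%:E = ((b `^ th - a `^ th) / th)%:E)%E.
Proof.
move=> a0 ab th0.
have d (x : R) : 0 < x -> is_derive x 1 (fun x : R => x `^ th / th) (x `^ (th - 1)).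
  move=> x0; have xI : x \in `]0, +oo[ by rewrite in_itv/= x0.
  have dx : derivable (@powR R ^~ th) x 1 by exact: derivable_powR.
  have e : 'D_1 (@powR R ^~ th) x = th * x `^ (th - 1).
    by rewrite -derive1E powR_derive1.
  have h : is_derive x 1 (@powR R ^~ th) (th * x `^ (th - 1)).
    by apply: DeriveDef.
  have -> : (fun x : R => x `^ th / th) = th^-1 \*: (@powR R ^~ th).
    by apply/funext => y /=; rewrite mulrC.
  apply: is_derive_eq; rewrite /GRing.scale/=; field; exact: th0.
have c (x : R) : 0 < x -> {for x, continuous (fun x : R => x `^ th / th)}.
  by move=> x0; apply/differentiable_continuous/derivable1_diffP; have [] := d _ x0.
have cpow (x : R) : 0 < x -> {for x, continuous (fun x : R => x `^ (th - 1))}.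
  move=> x0; have xI : x \in `]0, +oo[ by rewrite in_itv/= x0.
  by apply/differentiable_continuous/derivable1_diffP; exact: derivable_powR.
rewrite (@continuous_FTC2 _ _ (fun x : R => x `^ th / th))//.
- by rewrite -EFinB mulrBl.
- apply: continuous_in_subspaceT => x; rewrite inE/= in_itv/= => /andP[ax _].
  by apply: cpow; exact: lt_le_trans ax.
- split.
  + move=> x; rewrite in_itv/= => /andP[ax _].
    by have [] := d _ (lt_trans a0 ax).
  + exact/cvg_at_right_filter/c.
  + by apply/cvg_at_left_filter/c; exact: lt_trans ab.
- move=> x; rewrite in_itv/= => /andP[ax _].
  by rewrite derive1E; have h := d _ (lt_trans a0 ax); rewrite derive_val.
Qed.

Lemma integral_powR_near (k th : R) : 0 < k -> 0 < th ->
  (\int[mu]_(x in `]0%R, k]) (x `^ (th - 1))%:E <= (k `^ th / th)%:E)%E.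
Proof.
move=> k0 th0.
(* The denominator starts at 2 so that each left endpoint lies strictly below [k], as
   [integral_powR] requires. *)
have -> : `]0, k]%classic = \bigcup_i `[k / (i.+2)%:R, k]%classic.
  apply/seteqP; split => x /=.
    rewrite in_itv/= => /andP[x0 xk].
    exists (Num.truncn (k / x)) => //=; rewrite in_itv/= xk andbT.
    rewrite ler_pdivrMr// mulrC -ler_pdivrMr//.
    by apply/ltW/(lt_trans (truncnS_gt _)); rewrite ltr_nat.
  move=> [i _] /=; rewrite !in_itv/= => /andP[h ->]; rewrite andbT.
  by apply: lt_le_trans h; rewrite divr_gt0.
apply: ge0_integral_bigcup_le.
- move=> i j ij; apply/subsetPset => x /=; rewrite !in_itv/= => /andP[h ->].
  rewrite andbT; apply: le_trans h; rewrite ler_pM2l// lef_pV2 ?posrE//.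
  by rewrite ler_nat !ltnS.
- by move=> i; exact: measurable_itv.
- exact: measurable_powR_EFin.
- by move=> x; rewrite lee_fin powR_ge0.
move=> i; rewrite integral_powR ?divr_gt0 ?gt_eqF//; last first.
  by rewrite ltr_pdivrMr// ltr_pMr// ltr1n.
by rewrite lee_fin ler_wpM2r ?invr_ge0 ?(ltW th0)// lerBlDr lerDl powR_ge0.
Qed.

Lemma integral_powR_far (k s : R) : 0 < k -> 0 < s ->
  (\int[mu]_(x in `]k, +oo[) (x `^ (- s - 1))%:E <= (k `^ (- s) / s)%:E)%E.
Proof.
move=> k0 s0; rewrite integral_itv_obnd_cbnd; last exact: measurable_powR_EFin.
have -> : `[k, +oo[%classic = \bigcup_i `[k, k + (i.+1)%:R]%classic.
  apply/seteqP; split => x /=.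
    rewrite in_itv/= andbT => kx; exists (Num.truncn (x - k)) => //=.
    by rewrite in_itv/= kx/= -lerBlDl; exact/ltW/truncnS_gt.
  by move=> [i _] /=; rewrite !in_itv/= => /andP[->].
apply: ge0_integral_bigcup_le.
- move=> i j ij; apply/subsetPset => x /=; rewrite !in_itv/= => /andP[-> h].
  by apply: le_trans h _; rewrite lerD2l ler_nat ltnS.
- by move=> i; exact: measurable_itv.
- exact: measurable_powR_EFin.
- by move=> x; rewrite lee_fin powR_ge0.
move=> i; rewrite integral_powR ?ltrDl ?oppr_eq0 ?gt_eqF// lee_fin.
rewrite invrN mulrN -mulNr opprB ler_wpM2r ?invr_ge0 ?(ltW s0)//.
by rewrite lerBlDr lerDl powR_ge0.
Qed.

(* The heat kernel of order [s] has mass of order [sg^(-1-s)] at time lag [sg];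
   a cancellation of order [sg^be] below the lag [k] makes it integrable. *)
Definition lag_bound (k c1 be c2 sg : R) : R := if sg <= k then c1 * sg `^ be else c2.

Lemma lag_bound_ge0 k c1 be c2 sg : 0 <= c1 -> 0 <= c2 ->
  0 <= lag_bound k c1 be c2 sg.
Proof. by move=> ? ?; rewrite /lag_bound; case: ifP => // _; rewrite mulr_ge0 ?powR_ge0. Qed.

Lemma measurable_lag_bound d (S : measurableType d) k c1 be c2 (f : S -> R) :
  measurable_fun setT f -> measurable_fun setT (fun z => lag_bound k c1 be c2 (f z)).
Proof.
move=> mf; apply: measurable_fun_ifT.
- exact: measurable_fun_ler.
- by apply: measurable_funM => //; exact: (measurableT_comp (measurable_powR be)).
- by [].
Qed.

(** Splitting at [k], the near part converges because [s < be] and the far part because [0 < s].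
    With [be = 1], [c1] of order [ep / k] and [c2 = ep] both terms are of order [ep * k^-s], the
    scaling needed later. *)
Lemma integral_lag_bound_pos (k c1 be c2 s : R) : 0 < k -> 0 <= c1 -> 0 <= c2 ->
  0 < s -> s < be ->
  (\int[mu]_(x in `]0%R, +oo[) (lag_bound k c1 be c2 x * x `^ (- s - 1))%:E <=
   (c1 * (k `^ (be - s) / (be - s)) + c2 * (k `^ (- s) / s))%:E)%E.
Proof.
move=> k0 c10 c20 s0 sbe.
have mf : measurable_fun setT
    (fun x => (lag_bound k c1 be c2 x * x `^ (- s - 1))%:E).
  apply/measurable_EFinP; apply: measurable_funM; first exact: measurable_lag_bound.
  exact: measurable_powR.
have f0 x : (0 <= (lag_bound k c1 be c2 x * x `^ (- s - 1))%:E)%E.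
  by rewrite lee_fin mulr_ge0 ?powR_ge0 ?lag_bound_ge0.
have -> : `]0, +oo[%classic = `]0, k] `|` `]k, +oo[.
  apply/seteqP; split => x /=; rewrite !in_itv/= ?andbT.
    by move=> x0; case: (leP x k) => xk; [left; rewrite x0|right].
  by move=> [/andP[]//|]; exact: lt_trans.
rewrite ge0_integral_setU//=; last 2 first.
- exact: measurable_funTS.
- by apply/disj_setPS => x /= []; rewrite !in_itv/= andbT => /andP[_ xk]; rewrite ltNge xk.
rewrite EFinD; apply: leeD.
- apply: (@le_trans _ _ (\int[mu]_(x in `]0%R, k]) (c1%:E * (x `^ ((be - s) - 1))%:E))%E).
    apply: le_integral_nomeas => x; rewrite /= in_itv/= => /andP[x0 xk].
    rewrite /lag_bound xk lee_fin -mulrA -powRD; last by rewrite (gt_eqF x0) implybT.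
    by rewrite (_ : be + (- s - 1) = be - s - 1)//; ring.
  rewrite ge0_integralZl//.
  + by rewrite EFinM lee_wpmul2l// integral_powR_near// subr_gt0.
  + exact: measurable_powR_EFin.
  + by move=> x _; rewrite lee_fin powR_ge0.
- apply: (@le_trans _ _ (\int[mu]_(x in `]k, +oo[) (c2%:E * (x `^ (- s - 1))%:E))%E).
    apply: le_integral_nomeas => x; rewrite /= in_itv/= andbT => xk.
    by rewrite /lag_bound (lt_geF xk).
  rewrite ge0_integralZl//.
  + by rewrite EFinM lee_wpmul2l// integral_powR_far.
  + exact: measurable_powR_EFin.
  + by move=> x _; rewrite lee_fin powR_ge0.
Qed.

Lemma ge0_integral_lag t (f : R -> \bar R) : measurable_fun setT f ->
  (forall x, (0 <= f x)%E) ->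
  (\int[mu]_(x in `]-oo, t[) f (t - x)%R = \int[mu]_(x in `]0%R, +oo[) f x)%E.
Proof.
move=> mf f0.
rewrite (@ge0_integral_reflect _ t `]0, +oo[)//; last first.
  exact: (measurable_funTS mf).
rewrite (_ : reflect t @^-1` `]0, +oo[ = `]-oo, t[%classic)//.
by apply/seteqP; split => x /=; rewrite /reflect !in_itv/= andbT subr_gt0.
Qed.

Lemma integral_lag_bound (t k c1 be c2 s : R) : 0 < k -> 0 <= c1 -> 0 <= c2 ->
  0 < s -> s < be ->
  (\int[mu]_(x in `]-oo, t[) (lag_bound k c1 be c2 (t - x) * (t - x) `^ (- s - 1))%:E <=
   (c1 * (k `^ (be - s) / (be - s)) + c2 * (k `^ (- s) / s))%:E)%E.
Proof.
move=> k0 c10 c20 s0 sbe.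
rewrite (ge0_integral_lag t
  (f := fun x => (lag_bound k c1 be c2 x * x `^ (- s - 1))%:E)).
- exact: integral_lag_bound_pos.
- apply/measurable_EFinP; apply: measurable_funM; first exact: measurable_lag_bound.
  exact: measurable_powR.
- by move=> x; rewrite lee_fin mulr_ge0 ?powR_ge0 ?lag_bound_ge0.
Qed.

(** Since [gammaR] is defined with [fine], its positivity requires the Gamma integral to be finite
    as well as positive. The interval [[1, 2]] bounds it from below. From above the integrand is at
    most [x^-s] up to 1 and, by [x exp(-x) <= 1], at most [x^(-s-1)] beyond: this is [lag_bound]
    with all parameters equal to 1. *)
Lemma Cns_gt0 n (s : R) : 0 < s < 1 -> 0 < Cns n s.
Proof.
move=> /andP[s0 s1].
suff g0 : 0 < gammaR (1 - s).
  by rewrite /Cns mul1r invr_gt0 mulr_gt0 ?powR_gt0 ?divr_gt0 ?mulr_gt0 ?pi_gt0.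
rewrite /gammaR fine_gt0//.
have mf : measurable_fun setT (fun x : R => (x `^ (1 - s - 1) * expR (- x))%:E).
  apply/measurable_EFinP; apply: measurable_funM; first exact: measurable_powR.
  by apply: (measurableT_comp (@measurable_expR R)); exact: oppr_measurable.
have f0 (x : R) : (0 <= (x `^ (1 - s - 1) * expR (- x))%:E)%E.
  by rewrite lee_fin mulr_ge0 ?powR_ge0 ?expR_ge0.
apply/andP; split.
  apply: (@lt_le_trans _ _ (\int[mu]_(x in `[1%R, 2%R]) (cst (2 `^ (- s) * expR (- 2))%:E x))%E).
    rewrite integral_cst//= lebesgue_measure_itv/= lte_fin ltr1n -EFinB -EFinM lte_fin.
    by rewrite !mulr_gt0 ?powR_gt0 ?expR_gt0//; lra.
  apply: (@le_trans _ _ (\int[mu]_(x in `[1%R, 2%R]) (x `^ (1 - s - 1) * expR (- x))%:E)%E).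
    apply: le_integral_nomeas => x /=; rewrite in_itv/= => /andP[x1 x2].
    rewrite lee_fin ler_pM ?powR_ge0 ?expR_ge0//; last by rewrite ler_expR lerN2.
    rewrite (_ : 1 - s - 1 = - s); last by ring.
    rewrite !powRN lef_pV2 ?posrE ?powR_gt0//; last by lra.
    by rewrite ge0_ler_powR ?nnegrE//; lra.
  apply: ge0_subset_integral_nomeas => //.
  by move=> x /=; rewrite !in_itv/= andbT => /andP[x1 _]; lra.
apply: le_lt_trans (ltry (1 * (1 `^ (1 - s) / (1 - s)) + 1 * (1 `^ (- s) / s))).
apply: le_trans (@integral_lag_bound_pos 1 1 1 1 s _ _ _ _ _) => //.
apply: le_integral_nomeas => x /=; rewrite in_itv/= andbT => x0.
rewrite lee_fin /lag_bound.
have e1 : expR (- x) <= 1 by rewrite -expR0 ler_expR; lra.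
case: ifP => x1.
  rewrite mul1r -powRD; last by rewrite (gt_eqF x0) implybT.
  rewrite (_ : 1 + (- s - 1) = 1 - s - 1); last by ring.
  by rewrite ler_piMr ?powR_ge0.
rewrite mul1r (_ : 1 - s - 1 = 1 + (- s - 1)); last by ring.
rewrite powRD; last by rewrite (gt_eqF x0) implybT.
rewrite powRr1 ?(ltW x0)// mulrAC ler_piMl ?powR_ge0//.
rewrite expRN ler_pdivrMr ?expR_gt0// mul1r.
by apply: le_trans (expR_ge1Dx x); lra.
Qed.

End power_integrals.

(** * Euclidean norm and parabolic Taylor expansion *)

Section taylor.
Context {R : realType}.

Lemma enormN n (h : 'rV[R]_n) : enorm (- h) = enorm h.
Proof. by rewrite /enorm; congr Num.sqrt; apply: eq_bigr => i _; rewrite mxE sqrrN. Qed.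

Lemma enormB n (x y : 'rV[R]_n) : enorm (x - y) = enorm (y - x).
Proof. by rewrite -enormN opprB. Qed.

Lemma enormZ n a (h : 'rV[R]_n) : enorm (a *: h) = `|a| * enorm h.
Proof.
rewrite /enorm (eq_bigr (fun i => a ^+ 2 * h ord0 i ^+ 2)) => [|i _].
  by rewrite -mulr_sumr sqrtrM ?sqr_ge0// sqrtr_sqr.
by rewrite mxE exprMn.
Qed.

Lemma coord_le_enorm n (h : 'rV[R]_n) i : `|h ord0 i| <= enorm h.
Proof.
rewrite -sqrtr_sqr /enorm ler_wsqrtr// (bigD1 i)//= lerDl.
by rewrite sumr_ge0// => j _; exact: sqr_ge0.
Qed.

Lemma enorm_le_sum n (h : 'rV[R]_n) : enorm h <= \sum_i `|h ord0 i|.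
Proof.
have s0 : 0 <= \sum_i `|h ord0 i| by rewrite sumr_ge0.
rewrite -[leRHS](ger0_norm s0) -sqrtr_sqr ler_wsqrtr//.
rewrite [leRHS]expr2 mulr_suml ler_sum// => i _.
rewrite -real_normK ?num_real// expr2 ler_wpM2l//.
by rewrite (bigD1 i)//= lerDl sumr_ge0.
Qed.

Lemma dotp_le n (c h : 'rV[R]_n) : `|dotp c h| <= (\sum_i `|c ord0 i|) * enorm h.
Proof.
rewrite /dotp mulr_suml; apply: le_trans (ler_norm_sum _ _ _) _.
by apply: ler_sum => i _; rewrite normrM ler_wpM2l// coord_le_enorm.
Qed.

Lemma is_derive_segment n (f : 'rV[R]_n -> R) (x h : 'rV[R]_n) (th : R) :
  differentiable f (x + th *: h) ->
  is_derive th 1 (fun r : R => f (x + r *: h))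
    (\sum_i h ord0 i * 'D_(delta_mx ord0 i) f (x + th *: h)).
Proof.
move=> df; have E : (fun k : R => k^-1 *: (((fun r : R => f (x + r *: h)) \o shift th) (k *: 1)
    - f (x + th *: h))) =
    (fun k : R => k^-1 *: ((f \o shift (x + th *: h)) (k *: h) - f (x + th *: h))).
  apply/funext => k /=; congr (_ *: (f _ - _)).
  rewrite (_ : k *: (1 : R) = k); last exact: mulr1.
  by rewrite scalerDl addrCA.
split; first by rewrite /derivable E; exact: diff_derivable.
rewrite /derive E -/(derive f (x + th *: h) h) deriveE//.
move: (x + th *: h) df {E} => p df.
rewrite {1}(row_sum_delta h) linear_sum; apply: eq_bigr => i _.
by rewrite linearZ/= -deriveE.
Qed.

Lemma segment_mvt n (f : 'rV[R]_n -> R) (x h : 'rV[R]_n) :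
  (forall th : R, 0 <= th <= 1 -> differentiable f (x + th *: h)) ->
  exists2 th : R, 0 <= th <= 1 &
    f (x + h) - f x = \sum_i h ord0 i * 'D_(delta_mx ord0 i) f (x + th *: h).
Proof.
move=> df.
have [||th] := @MVT_segment _ (fun r : R => f (x + r *: h))
  (fun r => \sum_i h ord0 i * 'D_(delta_mx ord0 i) f (x + r *: h)) 0 1 ler01.
- by move=> r; rewrite in_itv/= => /andP[r0 r1]; apply/is_derive_segment/df; rewrite !ltW.
- apply: continuous_in_subspaceT => r; rewrite inE/= in_itv/= => r01.
  apply/differentiable_continuous/derivable1_diffP.
  by have [] := is_derive_segment (df _ r01).
- by rewrite in_itv/= scale1r scale0r addr0 subr0 mulr1 => ? ?; exists th.
Qed.

Let near n (x : 'rV[R]_n) (t d : R) : set ('rV[R]_n * R) :=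
  [set p | enorm (p.1 - x) < d /\ `|p.2 - t| <= d].

Let segment_near n (x y : 'rV[R]_n) t d th : enorm (y - x) < d ->
  0 <= th <= 1 -> near x t d (x + th *: (y - x), t).
Proof.
move=> yd /andP[th0 th1].
have d0 : 0 < d by apply: le_lt_trans yd; exact: enorm_ge0.
split => /=; last by rewrite subrr normr0 ltW.
rewrite addrAC subrr add0r enormZ ger0_norm//.
by apply: le_lt_trans yd; rewrite ler_piMl ?enorm_ge0.
Qed.

(** The increment is split at [(y, t)]: the time part is bounded by the Hoelder condition in [t],
    the space part by the mean value theorem on the segment from [x] to [y], with the gradient
    replaced by its value at [x]. Only a bound from above is needed. *)
Let taylor_bound n (u : 'rV[R]_n -> R -> R) x t d ga C : 0 <= C -> 1 <= ga ->
  (forall y, near x t d (y, t) -> differentiable (fun z => u z t) y) ->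
  (forall y tau, near x t d (y, tau) ->
     `|u y t - u y tau| <= C * `|t - tau| `^ (ga / 2)) ->
  (forall y i, near x t d (y, t) ->
     `|pdx u i y t - pdx u i x t| <= C * enorm (y - x) `^ (ga - 1)) ->
  forall y tau, enorm (y - x) < d -> 0 < t - tau <= d ->
    u x t - u y tau <= dotp (\row_i - pdx u i x t) (y - x) +
      C * (n%:R + 1) * (enorm (y - x) `^ ga + (t - tau) `^ (ga / 2)).
Proof.
move=> C0 ga1 du ut ux y tau yd /andP[tau0 taud].
have e0 := enorm_ge0 (y - x).
have [th th01] := segment_mvt (x := x) (h := y - x) (f := fun z => u z t)
   (fun th h => du _ (segment_near t yd h)).
rewrite subrKC => E.
have hyt : near x t d (y, tau) by split=> //=; rewrite distrC gtr0_norm.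
have := ut y tau hyt; rewrite [`|_ - tau|]gtr0_norm//.
move=> /ler_normlP[_ utau].
set hn := enorm (y - x) in e0 yd *.
have hx : - \sum_i (y - x) ord0 i * pdx u i (x + th *: (y - x)) t <=
    dotp (\row_i - pdx u i x t) (y - x) + C * n%:R * hn `^ ga.
  rewrite -lerBlDl /dotp -sumrN -sumrB.
  have -> : C * n%:R * hn `^ ga = \sum_(i < n) C * hn `^ ga.
    by rewrite sumr_const card_ord -mulr_natr; ring.
  apply: ler_sum => i _.
  have := ux _ i (segment_near t yd th01).
  rewrite addrAC subrr add0r enormZ -/hn => h.
  have : `|(y - x) ord0 i * (pdx u i (x + th *: (y - x)) t - pdx u i x t)| <= C * hn `^ ga.
    rewrite normrM.
    have -> : hn `^ ga = hn * hn `^ (ga - 1).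
      rewrite -[X in _ = X * _]powRr1// -powRD; first by congr (_ `^ _); ring.
      apply/implyP => /eqP g0; rewrite gt_eqF//.
      by exfalso; lra.
    rewrite mulrCA ler_pM//; first exact: coord_le_enorm.
    apply: le_trans h _; rewrite ler_wpM2l// ge0_ler_powR ?nnegrE//; first by lra.
      by rewrite mulr_ge0.
    by case/andP: th01 => th0 th1; rewrite ger0_norm// ler_piMl.
  by move=> /ler_normlP[]; rewrite [(\row__ _) _ _]mxE; lra.
have p1 : 0 <= hn `^ ga by exact: powR_ge0.
have p2 : 0 <= (t - tau) `^ (ga / 2) by exact: powR_ge0.
have n0 : (0 : R) <= n%:R by [].
rewrite (_ : C * (n%:R + 1) * _ = C * n%:R * hn `^ ga + C * (t - tau) `^ (ga / 2) +
  C * (hn `^ ga + n%:R * (t - tau) `^ (ga / 2))); last by ring.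
have : 0 <= C * (hn `^ ga + n%:R * (t - tau) `^ (ga / 2)).
  by rewrite mulr_ge0// addr_ge0// mulr_ge0.
move: E utau hx; rewrite /pdx.
by set S := \sum_i _; lra.
Qed.

(** The regularity hypothesis speaks of compact sets only. A closed box serves, since balls of row
    vectors are taken in the sup norm, and each coordinate is at most [enorm]. *)
Let compact_near n (Om : set 'rV[R]_n) x t : open Om -> Om x ->
  exists2 d : R, 0 < d & exists2 K, compact K & K `<=` Om `*` setT /\ near x t d `<=` K.
Proof.
move=> oOm Omx; have /nbhs_ballP[e /= e0 eO] := oOm _ Omx.
exists (e / 2); first by lra.
exists ([set v : 'rV[R]_n | forall i, `[x ord0 i - e / 2, x ord0 i + e / 2]%classic (v ord0 i)]
  `*` `[t - e / 2, t + e / 2]%classic).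
  apply: compact_setX; last exact: segment_compact.
  apply: (@rV_compact R n (fun i => `[x ord0 i - e / 2, x ord0 i + e / 2]%classic)).
  by move=> i; exact: segment_compact.
split => [[y tau] [/= hy _]|[y tau] [/= hy ht]]; split => //=.
- apply: eO; split => // i j; rewrite (ord1 i) /ball/=.
  have := hy j; rewrite in_itv/= => /andP[? ?].
  by rewrite ltr_distl; apply/andP; split; lra.
- move=> i; rewrite in_itv/= -ler_distl; apply: ltW; apply: le_lt_trans hy.
  by have := coord_le_enorm (y - x) i; rewrite !mxE.
- by rewrite in_itv/= -ler_distl.
Qed.

Let hol_low_bounded n (f : 'rV[R]_n -> R -> R) K b x t d : 0 <= b -> 0 < d ->
  near x t d `<=` K -> hol_low b f K ->
  exists2 B : R, 0 <= B & forall y tau, near x t d (y, tau) -> `|f y tau| <= B.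
Proof.
move=> b0 d0 dK [C hC]; exists (`|f x t| + `|C| * (d + Num.sqrt d) `^ (2 * b)).
  by rewrite addr_ge0// mulr_ge0// powR_ge0.
move=> y tau yt.
have nx : near x t d (x, t).
  split => /=; last by rewrite subrr normr0 ltW.
  by rewrite subrr /enorm big1 ?sqrtr0// => i _; rewrite mxE expr0n.
have h := hC y x tau t (dK _ yt) (dK _ nx).
have -> : f y tau = f x t + (f y tau - f x t) by ring.
apply: le_trans (ler_normD _ _) _; rewrite lerD2l.
apply: le_trans h _; apply: (@le_trans _ _ (`|C| * (enorm (y - x) + Num.sqrt `|tau - t|) `^ (2 * b))).
  by rewrite ler_wpM2r ?powR_ge0// ler_norm.
case: yt => /= yd td.
rewrite ler_wpM2l// ge0_ler_powR ?nnegrE//.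
- by rewrite mulr_ge0.
- by rewrite addr_ge0 ?enorm_ge0 ?sqrtr_ge0.
- by rewrite addr_ge0 ?sqrtr_ge0 ?ltW.
- by rewrite lerD ?(ltW yd)// ler_wsqrtr.
Qed.

Lemma powR_add_le (p q r : R) : 0 <= p -> 0 <= q -> 0 < r <= 1 ->
  (p + q) `^ r <= 2 * (p `^ r + q `^ r).
Proof.
move=> p0 q0 /andP[r0 r1].
wlog pq : p q p0 q0 / p <= q.
  move=> H; case: (leP p q) => [|/ltW] pq; first exact: H.
  by rewrite addrC [X in _ <= 2 * X]addrC; exact: H.
apply: (@le_trans _ _ ((2 * q) `^ r)).
  by rewrite ge0_ler_powR ?nnegrE ?(ltW r0)//; lra.
rewrite powRM//; apply: ler_pM; rewrite ?powR_ge0//.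
  by rewrite -[leRHS]powRr1// ler_powR//; lra.
by rewrite lerDr powR_ge0.
Qed.

(** What matters is [2 * s < ga]: the remainder then beats the singularity of the kernel. With
    [a = s + eps / 2] one has [2 * a = 2 * s + eps], and [ga = 2 * a] works as long as [a <= 1],
    with no linear term if [a <= 1 / 2]. For [a > 1] the exponent is capped at 2, which still
    exceeds [2 * s]; boundedness of the time derivative and of the second space derivatives is then
    enough. *)
Lemma parabolic_taylor n (s eps : R) (Om : set 'rV[R]_n) u x t :
  0 < s < 1 -> 0 < eps < 1 -> open Om -> parabolic_holder_loc (s + eps / 2) Om u ->
  Om x ->
  exists c C ga d, [/\ 0 <= C, 2 * s < ga <= 2, 0 < d &
    forall y tau, enorm (y - x) < d -> 0 < t - tau <= d ->
      u x t - u y tau <= dotp c (y - x) +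
        C * (enorm (y - x) `^ ga + (t - tau) `^ (ga / 2))].
Proof.
move=> /andP[s0 s1] /andP[e0 e1] oOm hu Omx.
have [d d0 [K cK [KO dK]]] := compact_near t oOm Omx.
have nx : near x t d (x, t).
  split => /=; last by rewrite subrr normr0 ltW.
  by rewrite subrr /enorm big1 ?sqrtr0// => i _; rewrite mxE expr0n.
have := hu K cK KO; set a := s + eps / 2.
case: ifPn => [a12|].
  move=> [C hC]; exists 0, (`|C| * 2), (2 * a), d; split => //.
  - by apply/andP; split; rewrite /a in a12 *; lra.
  move=> y tau yd /andP[tau0 taud].
  have yt : near x t d (y, tau) by split=> //=; rewrite distrC gtr0_norm.
  have := hC _ _ _ _ (dK _ nx) (dK _ yt); rewrite [`|t - _|]gtr0_norm// enormB.
  move=> /ler_normlP[_ h]; apply: le_trans h _.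
  rewrite /dotp big1 ?add0r; last by move=> i _; rewrite mxE mul0r.
  apply: (@le_trans _ _ (`|C| * (enorm (y - x) + Num.sqrt (t - tau)) `^ (2 * a))).
    by rewrite ler_wpM2r ?powR_ge0// ler_norm.
  rewrite -mulrA ler_wpM2l//.
  have -> : (t - tau) `^ (2 * a / 2) = Num.sqrt (t - tau) `^ (2 * a).
    by rewrite -powR12_sqrt ?(ltW tau0)// -powRrM; congr (_ `^ _); field.
  apply: powR_add_le; [exact: enorm_ge0|exact: sqrtr_ge0|].
  by apply/andP; split; rewrite /a in a12 *; lra.
rewrite -ltNge => a12; case: ifPn => [a1|].
  move=> [du [C [ht hx]]].
  exists (\row_i - pdx u i x t), (`|C| * (n%:R + 1)), (2 * a), d; split => //.
  - by apply/andP; split; rewrite /a in a1 *; lra.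
  apply: taylor_bound => //; first by lra.
  - by move=> y /dK; exact: du.
  - move=> y tau [/= yd td]; rewrite (_ : 2 * a / 2 = a); last by field.
    have h : K (y, tau) by apply: dK.
    have h' : K (y, t) by apply: dK; split => //=; rewrite subrr normr0 ltW.
    apply: le_trans (ht _ _ _ h' h) _.
    by rewrite ler_wpM2r ?powR_ge0// ler_norm.
  - move=> y i /dK hy; apply: le_trans ((hx i).1 _ _ _ hy (dK _ nx)) _.
    by rewrite ler_wpM2r ?powR_ge0// ler_norm.
rewrite -ltNge => a1 [du [ht hxx]].
have [B1 B10 hB1] := hol_low_bounded (ltW (eqbRL (subr_gt0 _ _) a1)) d0 dK ht.
have /choice[B2 hB2] : forall i, exists B : R, 0 <= B /\
    forall j y tau, near x t d (y, tau) -> `|pdx (pdx u i) j y tau| <= B.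
  move=> i.
  have /choice[B hB] : forall j, exists B : R, 0 <= B /\
      forall y tau, near x t d (y, tau) -> `|pdx (pdx u i) j y tau| <= B.
    move=> j; have [B B0 hB] := hol_low_bounded (ltW (eqbRL (subr_gt0 _ _) a1)) d0 dK (hxx i j).
    by exists B.
  exists (\sum_j B j); split; first by rewrite sumr_ge0// => j _; case: (hB j).
  move=> j y tau h; apply: le_trans ((hB j).2 _ _ h) _.
  by rewrite (bigD1 j)//= lerDl sumr_ge0// => k _; case: (hB k).
pose B3 := \sum_i B2 i.
have B30 : 0 <= B3 by rewrite sumr_ge0// => i _; case: (hB2 i).
have B2B3 i : B2 i <= B3.
  by rewrite /B3 (bigD1 i)//= lerDl sumr_ge0// => k _; case: (hB2 k).
(* [B1] is a Lipschitz constant in time; [n * B3] is one for each component of the gradient, whose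
   increment is a sum of [n] second derivatives. *)
pose C := B1 + n%:R * B3.
have nB : 0 <= n%:R * B3 by rewrite mulr_ge0.
exists (\row_i - pdx u i x t), (C * (n%:R + 1)), 2, d; split => //.
- by rewrite mulr_ge0 ?addr_ge0.
- by apply/andP; split; lra.
apply: taylor_bound => //; first by rewrite addr_ge0.
- by lra.
- by move=> y /dK /du[].
- move=> y tau [/= yd td]; rewrite divff// powRr1//.
  have mid r : `|r - t| <= d -> near x t d (y, r) by [].
  have D r : `|r - t| <= d -> is_derive r 1 (fun r => u y r) (pdt u y r).
    by move=> /mid/dK/du[_ dr _]; apply: DeriveDef.
  have key p q : `|p - t| <= d -> `|q - t| <= d -> p <= q -> `|u y q - u y p| <= C * `|q - p|.
    move=> pd qd pq.
    have inside r : p <= r <= q -> `|r - t| <= d.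
      by move: pd qd; rewrite !ler_distl => /andP[? ?] /andP[? ?] /andP[? ?]; apply/andP; split; lra.
    have [||c] := @MVT_segment _ (fun r => u y r) (fun r => pdt u y r) p q pq.
    - by move=> r; rewrite in_itv/= => /andP[? ?]; apply/D/inside; rewrite !ltW.
    - apply: continuous_in_subspaceT => r; rewrite inE/= in_itv/= => /inside/D[dr _].
      exact/differentiable_continuous/derivable1_diffP.
    rewrite in_itv/= => /inside/mid/hB1 hc ->; rewrite normrM ler_wpM2r//.
    by apply: le_trans hc _; rewrite lerDl.
  have tt : `|t - t| <= d by rewrite subrr normr0 ltW.
  case: (leP tau t) => h; first exact: key.
  by rewrite distrC [X in _ * X]distrC; apply: key => //; exact: ltW.
- move=> y i [/= yd _]; rewrite (_ : 2 - 1 = 1); last by ring.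
  rewrite powRr1 ?enorm_ge0//.
  have [|th th01] := @segment_mvt n (fun z => pdx u i z t) x (y - x).
    by move=> th th01; have /dK/du[_ _] := segment_near t yd th01; exact.
  rewrite subrKC => ->.
  apply: le_trans (ler_norm_sum _ _ _) _.
  apply: (@le_trans _ _ (\sum_(j < n) enorm (y - x) * B3)).
    apply: ler_sum => j _; rewrite normrM ler_pM//; first exact: coord_le_enorm.
    apply: le_trans (B2B3 i); apply: (hB2 i).2; exact: segment_near.
  rewrite sumr_const card_ord -mulr_natl mulrCA mulrC ler_wpM2r ?enorm_ge0//.
  by rewrite lerDr.
Qed.

End taylor.

(** * Existence of the penalized maximum; decay of the kernel away from its pole *)

Section maximum_point.
Context {R : realType}.

(** The superlevel sets [w > S - e] in [K] generate a proper filter. Near a cluster point [p]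
    semicontinuity keeps [w] below [w p + e / 2], yet values above [S - e / 2] occur there, so [w p]
    reaches the supremum [S]. *)
Lemma usc_attains_max (T : topologicalType) (K : set T) (w : T -> R) (M : R) :
  compact K -> K !=set0 -> (forall q, K q -> w q <= M) ->
  (forall p, K p -> forall e, 0 < e -> \forall q \near p, K q -> w q < w p + e) ->
  exists2 p, K p & forall q, K q -> w q <= w p.
Proof.
move=> cK [p0 Kp0] wM usc.
pose S := sup (w @` K).
have hs : has_sup (w @` K).
  by split; [exists (w p0), p0|exists M => _ [q Kq <-]; exact: wM].
pose B (e : R) := [set q | K q /\ S - e < w q].
have pF : ProperFilter (filter_from [set e : R | 0 < e] B).
  apply: filter_from_proper => [|e e0].
    apply: filter_from_filter; first by exists 1 => /=.
    move=> i j i0 j0; exists (Num.min i j) => /=; first by rewrite lt_min i0.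
    move=> q [Kq h]; have : Num.min i j <= i by rewrite ge_min lexx.
    have : Num.min i j <= j by rewrite ge_min lexx orbT.
    by split; split=> //; lra.
  have [_ [q Kq <-] h] := sup_adherent e0 hs.
  by exists q.
have FK : filter_from [set e : R | 0 < e] B K by exists 1 => //= q [].
have [p [Kp clp]] := cK _ pF FK.
exists p => // q Kq; apply/ler_addgt0Pr => e e0.
have wqS : w q <= S by apply: ub_le_sup; [exact: hs.2|exists q].
have e20 : 0 < e / 2 by lra.
have FB : filter_from [set e : R | 0 < e] B (B (e / 2)) by exists (e / 2).
have [z [[Kz hz] wz]] := clp _ _ FB (usc p Kp _ e20).
by have := wz Kz; lra.
Qed.

(** No smooth cutoff is used: a quadratic polynomial has an exact second-order expansion, and its
    negativity outside a parabolic neighbourhood of [(x0, t0)] is all the localization needed. *)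
Definition bump n (x0 : 'rV[R]_n) (t0 rho : R) (y : 'rV[R]_n) (tau : R) : R :=
  1 - enorm (y - x0) ^+ 2 / rho - (tau - t0) ^+ 2 / rho ^+ 2.

Lemma continuous_bump n (x0 : 'rV[R]_n) t0 rho :
  continuous (fun p : 'rV[R]_n * R => bump x0 t0 rho p.1 p.2).
Proof.
have sq (f : 'rV[R]_n * R -> R) p : f x @[x --> p] --> f p ->
    f x ^+ 2 @[x --> p] --> f p ^+ 2.
  by move=> cf; exact: (cvg_comp _ _ cf (@exprn_continuous R 2 (f p))).
move=> p; rewrite /bump; apply: cvgB; last first.
  apply: cvgMr_tmp; apply: (sq (fun p => p.2 - t0)).
  by apply: cvgB; [exact: cvg_snd|exact: cvg_cst].
apply: cvgB; first exact: cvg_cst.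
apply: cvgMr_tmp; under eq_fun do rewrite enorm_sqr; rewrite enorm_sqr.
suff key (r : seq 'I_n) : \sum_(i <- r) (x.1 - x0) ord0 i ^+ 2 @[x --> p] -->
  \sum_(i <- r) (p.1 - x0) ord0 i ^+ 2 by exact: key.
elim: r => [|i r ih].
  rewrite big_nil; under eq_cvg do rewrite big_nil.
  exact: cvg_cst.
rewrite big_cons; under eq_cvg do rewrite big_cons.
apply: cvgD ih; apply: (sq (fun p => (p.1 - x0) ord0 i)).
rewrite !mxE; under eq_cvg do rewrite !mxE.
apply: cvgB; last exact: cvg_cst.
have c1 : fst x @[x --> p] --> p.1 by exact: cvg_fst.
exact: (cvg_comp _ _ c1 (@coord_continuous R 1 n ord0 i p.1)).
Qed.

(** The value at [(x0, t0)] already exceeds [A]. Where [bump <= 0] the penalized function is at most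
    [A], and outside [Om] it is at most [ep <= A / 2]; so a maximum over a compact part of the
    closure is attained in [Om] and is global. *)
Lemma penalized_max n (Om : set 'rV[R]_n) (u : 'rV[R]_n -> R -> R) A ep x0 t0 rho :
  usc_up_to_boundary Om u ->
  (forall x t, Om x -> u x t <= A) -> (forall x t, ~ Om x -> u x t <= 0) ->
  0 < ep -> ep <= A / 2 -> 0 < rho -> Om x0 -> A - ep < u x0 t0 ->
  exists x t, [/\ Om x, 0 < bump x0 t0 rho x t,
    A < u x t + ep * bump x0 t0 rho x t &
    forall y tau, Om y -> u y tau + ep * bump x0 t0 rho y tau <=
                          u x t + ep * bump x0 t0 rho x t].
Proof.
move=> usc uA u0 ep0 epA rho0 Ox0 ux0.
have bump1 y tau : bump x0 t0 rho y tau <= 1.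
  rewrite /bump; have : 0 <= enorm (y - x0) ^+ 2 / rho by rewrite divr_ge0 ?sqr_ge0 ?ltW.
  have : 0 <= (tau - t0) ^+ 2 / rho ^+ 2 by rewrite divr_ge0 ?sqr_ge0.
  by lra.
have bump00 : bump x0 t0 rho x0 t0 = 1.
  by rewrite /bump enorm_sqr big1 => [|i _]; rewrite ?mxE subrr expr0n ?mul0r/= ?subr0.
(* Half-width [rho + 1] avoids the square root of [rho]: [a^2 < rho] gives
   [a <= 1 + a^2 < rho + 1]. *)
pose box := [set v : 'rV[R]_n | forall i,
  `[x0 ord0 i - (rho + 1), x0 ord0 i + (rho + 1)]%classic (v ord0 i)].
pose K := (box `&` closure Om) `*` `[t0 - rho, t0 + rho]%classic.
have cK : compact K.
  apply: compact_setX; last exact: segment_compact.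
  apply: compact_closedI; last exact: closed_closure.
  apply: (@rV_compact R n (fun i => `[x0 ord0 i - (rho + 1), x0 ord0 i + (rho + 1)]%classic)).
  by move=> i; exact: segment_compact.
have Kx0 : K (x0, t0).
  split; last by rewrite /= in_itv/=; apply/andP; split; lra.
  split; last exact: subset_closure.
  by move=> i; rewrite /= in_itv/=; apply/andP; split; lra.
pose w (p : 'rV[R]_n * R) := u p.1 p.2 + ep * bump x0 t0 rho p.1 p.2.
have uA' x t : u x t <= A.
  by have [/uA//|/u0 h] := pselect (Om x); apply: le_trans (h t) _; lra.
have [|||[x t] [[_ clx] _] wmax] := @usc_attains_max _ K w (A + ep) cK.
- by exists (x0, t0).
- by move=> [y tau] _; apply: lerD => //; rewrite ler_piMr ?(ltW ep0).
- move=> [y tau] [[_ cly] _] e e0.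
  have e20 : 0 < e / 2 by lra.
  have [d d0 hd] := usc y tau cly _ e20.
  have := @continuous_bump n x0 t0 rho (y, tau).
  have eep : 0 < e / 2 / ep by rewrite divr_gt0.
  move=> /cvgrPdist_lt/(_ _ eep) nb.
  have nu : \forall q \near (y, tau), closure Om q.1 -> u q.1 q.2 < u y tau + e / 2.
    (* Passage from the sup norm to [enorm]: the [n] coordinates add up to at most
       [n * d / (n + 1)], which is strictly below [d]. *)
    apply/nbhs_ballP; exists (d / n.+1%:R) => /=; first by rewrite divr_gt0.
    move=> [z sg] [/= [_ hz] hsg] clz; apply: hd => //.
      apply: le_lt_trans (enorm_le_sum _) _.
      apply: (@le_lt_trans _ _ (\sum_(i < n) d / n.+1%:R)).
        apply: ler_sum => i _; apply: ltW; rewrite !mxE distrC.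
        exact: hz.
      rewrite sumr_const card_ord -[_ *+ n]mulr_natr -mulrA gtr_pMr//.
      by rewrite mulrC ltr_pdivrMr// mul1r ltr_nat.
    rewrite distrC; apply: lt_le_trans hsg _.
    by rewrite ler_pdivrMr// ler_peMr ?(ltW d0)// ler1n.
  near=> q => Kq; rewrite /w/=.
  have h1 : u q.1 q.2 < u y tau + e / 2.
    by apply: (near nu q) => //; case: Kq => -[].
  have : `|bump x0 t0 rho y tau - bump x0 t0 rho q.1 q.2| < e / 2 / ep by near: q.
  rewrite ltr_pdivlMr// => /(le_lt_trans _) h2.
  have : ep * (bump x0 t0 rho q.1 q.2 - bump x0 t0 rho y tau) < e / 2.
    by apply: h2; rewrite mulrC ler_wpM2r ?(ltW ep0)// distrC ler_norm.
  lra.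
have wA : A < u x t + ep * bump x0 t0 rho x t.
  have /= := wmax _ Kx0; rewrite /w/= bump00.
  by move=> h; lra.
have Ox : Om x.
  apply: contrapT => nOx; have ux := u0 x t nOx.
  have := bump1 x t; have : ep * bump x0 t0 rho x t <= ep by rewrite ler_piMr ?(ltW ep0).
  lra.
have bxt : 0 < bump x0 t0 rho x t.
  rewrite ltNge; apply/negP => b0; have := uA x t Ox.
  have : ep * bump x0 t0 rho x t <= 0 by rewrite mulr_ge0_le0 ?(ltW ep0).
  lra.
exists x, t; split => // y tau Oy.
have [Ky|nK] := pselect (K (y, tau)); first exact: (wmax _ Ky).
suff : bump x0 t0 rho y tau <= 0.
  move=> b0; have : ep * bump x0 t0 rho y tau <= 0 by rewrite mulr_ge0_le0 ?(ltW ep0).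
  by have := uA y tau Oy; lra.
rewrite leNgt; apply/negP => by0; apply: nK.
have p1 : 0 <= enorm (y - x0) ^+ 2 / rho by rewrite divr_ge0 ?sqr_ge0 ?ltW.
have p2 : 0 <= (tau - t0) ^+ 2 / rho ^+ 2 by rewrite divr_ge0 ?sqr_ge0.
rewrite /bump in by0.
have q1 : enorm (y - x0) ^+ 2 < rho.
  have : enorm (y - x0) ^+ 2 / rho < 1 by lra.
  by rewrite ltr_pdivrMr// mul1r.
have q2 : (tau - t0) ^+ 2 < rho ^+ 2.
  have : (tau - t0) ^+ 2 / rho ^+ 2 < 1 by lra.
  by rewrite ltr_pdivrMr ?exprn_gt0// mul1r.
split; [split|].
- move=> i; rewrite /= in_itv/= -ler_distl.
  have := coord_le_enorm (y - x0) i; rewrite !mxE => /le_trans; apply.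
  have := enorm_ge0 (y - x0); move: (enorm _) q1 => a; nra.
- exact: subset_closure.
- rewrite /= in_itv/= -ler_distl -(ler_pXn2r (n := 2)) ?nnegrE ?(ltW rho0)//.
  by rewrite real_normK ?num_real// ltW.
Unshelve. all: by end_near. Qed.

(** Young's inequality with optimal weights, [|y|^2 / be <= |x - y|^2 / al + |x|^2 / (be - al)]:
    coordinatewise the difference of the two sides is a perfect square. It moves the centre of a
    Gaussian from [x] to the origin. *)
Let heat_weight_sqr n (x y : 'rV[R]_n) (al be : R) : 0 < al -> al < be ->
  gauss al x y <= expR (enorm x ^+ 2 / (be - al)) * expR (- enorm y ^+ 2 / be).
Proof.
move=> al0 albe; rewrite /gauss -expRD ler_expR !enorm_sqr.
rewrite -!sumrN !mulr_suml -big_split/=; apply: ler_sum => i _.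
rewrite !mxE; set a := x ord0 i; set b := y ord0 i.
rewrite -subr_ge0.
have -> : a ^+ 2 / (be - al) + - b ^+ 2 / be - - (a - b) ^+ 2 / al =
    ((be - al) * (b - a) - al * a) ^+ 2 / (al * (be - al) * be).
  by field; rewrite !gt_eqF ?subr_gt0//; lra.
by rewrite divr_ge0 ?sqr_ge0// !mulr_ge0 ?subr_ge0 ?ltW//; lra.
Qed.

(* Away from the singularity the heat kernel is controlled by the weight that
   defines [calL] at the later time [t + 2]. *)
Lemma heat_le_weight n (x : 'rV[R]_n) (p k d : R) : 0 < p -> 0 < k <= 1 -> 0 < d ->
  exists2 C, 0 <= C & forall y sg, 0 < sg -> k < sg \/ d <= enorm (y - x) ->
    gauss (4 * sg) x y / sg `^ p <=
    C * (expR (- enorm y ^+ 2 / (4 * (sg + 2))) / (1 + (sg + 2) `^ p)).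
Proof.
move=> p0 /andP[k0 k1] d0.
(* [C1] serves lags above [k], where [sg + 2 <= (1 + 2 / k) * sg]; [C2] serves lags up to [k] at
   distance at least [d]. *)
pose C1 := expR (enorm x ^+ 2 / 8) * (2 * (1 + 2 / k) `^ p).
pose q := 8 * p / d ^+ 2.
pose C2 := expR (enorm x ^+ 2 / 4) * (q `^ p * (1 + 3 `^ p)).
have C10 : 0 <= C1 by rewrite !mulr_ge0 ?expR_ge0 ?powR_ge0.
have C20 : 0 <= C2 by rewrite !mulr_ge0 ?addr_ge0 ?expR_ge0 ?powR_ge0.
exists (C1 + C2); first by rewrite addr_ge0.
move=> y sg sg0 H.
have sp0 : 0 < sg `^ p by rewrite powR_gt0.
have w0 : 0 < 1 + (sg + 2) `^ p by rewrite addr_gt0 ?powR_gt0//; lra.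
have E0 := expR_gt0 (- enorm y ^+ 2 / (4 * (sg + 2))).
have [ksg|sgk] := ltP k sg.
  have h := @heat_weight_sqr n x y (4 * sg) (4 * (sg + 2)).
  have {}h := h ltac:(lra) ltac:(lra).
  have E : 4 * (sg + 2) - 4 * sg = 8 by ring.
  rewrite {}E in h.
  apply: (@le_trans _ _ (C1 * (expR (- enorm y ^+ 2 / (4 * (sg + 2))) / (1 + (sg + 2) `^ p)))); last first.
    by rewrite ler_wpM2r ?divr_ge0 ?(ltW E0) ?(ltW w0)// lerDl.
  have {h} : gauss (4 * sg) x y / sg `^ p <= expR (enorm x ^+ 2 / 8) *
      expR (- enorm y ^+ 2 / (4 * (sg + 2))) / sg `^ p.
    by rewrite ler_wpM2r ?invr_ge0 ?(ltW sp0).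
  move=> /le_trans; apply.
  rewrite (_ : C1 * _ = expR (enorm x ^+ 2 / 8) *
      expR (- enorm y ^+ 2 / (4 * (sg + 2))) *
      (2 * (1 + 2 / k) `^ p / (1 + (sg + 2) `^ p))); last by rewrite /C1; ring.
  rewrite ler_wpM2l ?mulr_ge0 ?expR_ge0//.
  rewrite ler_pdivlMr// mulrC ler_pdivrMr//.
  have h1 : 1 <= (sg + 2) `^ p.
    apply: (@le_trans _ _ (1 `^ p)); first by rewrite powR1.
    by rewrite ge0_ler_powR ?nnegrE ?(ltW p0)//; lra.
  apply: (@le_trans _ _ (2 * (sg + 2) `^ p)); first by lra.
  rewrite -mulrA ler_wpM2l// -powRM; last 2 first.
  - by rewrite addr_ge0// divr_ge0// ltW.
  - exact: ltW.
  have h2 : 0 < 2 / k by rewrite divr_gt0.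
  rewrite ge0_ler_powR ?nnegrE ?(ltW p0)//; [lra| |].
    by rewrite mulr_ge0 ?(ltW sg0)//; lra.
  rewrite mulrDl mul1r lerD2l mulrAC ler_pdivlMr//; lra.
have {H} dh : d <= enorm (y - x) by case: H => // h; have := lt_le_trans h sgk; rewrite ltxx.
apply: (@le_trans _ _ (C2 * (expR (- enorm y ^+ 2 / (4 * (sg + 2))) / (1 + (sg + 2) `^ p)))); last first.
  by rewrite ler_wpM2r ?divr_ge0 ?(ltW E0) ?(ltW w0)// lerDr.
have sg1 : sg <= 1 by exact: le_trans k1.
(* For lags up to 1 the width [8 * sg] stays below [4 * (sg + 2)] with a gap of at least 4; the
   shift by 2 provides this room. *)
have h := @heat_weight_sqr n x y (8 * sg) (4 * (sg + 2)) ltac:(lra) ltac:(lra).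
have {}h : gauss (8 * sg) x y <= expR (enorm x ^+ 2 / 4) *
    expR (- enorm y ^+ 2 / (4 * (sg + 2))).
  apply: le_trans h _; rewrite ler_wpM2r ?(ltW E0)// ler_expR.
  by rewrite ler_wpM2l ?sqr_ge0// lef_pV2 ?posrE//; lra.
pose z := d ^+ 2 / (8 * sg).
have z0 : 0 < z by rewrite divr_gt0 ?exprn_gt0//; lra.
have g4 : gauss (4 * sg) x y <= expR (- z) * gauss (8 * sg) x y.
  rewrite /gauss -expRD ler_expR enormB /z.
  have -> : - enorm (y - x) ^+ 2 / (4 * sg) =
      - enorm (y - x) ^+ 2 / (8 * sg) + - enorm (y - x) ^+ 2 / (8 * sg).
    by field; lra.
  rewrite lerD2r mulNr lerN2 ler_wpM2r ?invr_ge0//; first by lra.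
  by rewrite ler_pXn2r ?nnegrE ?enorm_ge0// ltW.
(* Half of the Gaussian absorbs the pole in [sg]: [exp(z / p) >= z / p], and [q] is chosen so that
   [q * (z / p) * sg = 1]. *)
have sgp : expR (- z) / sg `^ p <= q `^ p.
  have q0 : 0 < q by rewrite /q divr_gt0 ?exprn_gt0//; lra.
  rewrite expRN -invfM -[leLHS]mul1r ler_pdivrMr ?mulr_gt0 ?expR_gt0//.
  have -> : expR z = (expR (z / p)) `^ p by rewrite -expRM divfK// gt_eqF.
  have e0 := expR_gt0 (z / p).
  have es0 : 0 <= expR (z / p) * sg by rewrite mulr_ge0// ltW.
  have qes0 : 0 <= q * (expR (z / p) * sg) by apply: mulr_ge0 => //; exact: ltW.
  rewrite -!powRM ?(ltW q0) ?(ltW e0) ?(ltW sg0)//.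
  apply: (@le_trans _ _ (1 `^ p)); first by rewrite powR1.
  rewrite ge0_ler_powR ?nnegrE ?(ltW p0)//.
  have -> : 1 = q * (z / p * sg) by rewrite /q /z; field; rewrite !gt_eqF.
  rewrite ler_wpM2l ?(ltW q0)// ler_wpM2r ?(ltW sg0)//.
  by apply: le_trans (expR_ge1Dx _); lra.
apply: (@le_trans _ _ (q `^ p * (expR (enorm x ^+ 2 / 4) *
    expR (- enorm y ^+ 2 / (4 * (sg + 2)))))).
  apply: (@le_trans _ _ ((expR (- z) / sg `^ p) * gauss (8 * sg) x y)).
    by rewrite mulrAC ler_wpM2r ?invr_ge0 ?(ltW sp0).
  by rewrite ler_pM ?expR_ge0// divr_ge0 ?expR_ge0 ?(ltW sp0).
rewrite /C2 -!mulrA [leLHS]mulrCA ler_wpM2l ?expR_ge0//.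
rewrite ler_wpM2l ?powR_ge0// mulrCA ler_peMr ?(ltW E0)//.
rewrite ler_pdivlMr// mul1r lerD2l ge0_ler_powR ?nnegrE ?(ltW p0)//; lra.
Qed.

End maximum_point.

(** * Space-time integrals of the heat kernel; volume of balls *)

Section heat_kernel.
Context {R : realType}.
Notation mu := (@lebesgue_measure R).

Lemma measurable_inv_ge0 d (S : measurableType d) (f : S -> R) :
  measurable_fun setT f -> (forall z, 0 <= f z) ->
  measurable_fun setT (fun z => (f z)^-1).
Proof.
move=> mf f0; rewrite (_ : (fun z => _) = fun z => f z `^ (-1)).
  exact: (measurableT_comp (measurable_powR (-1))).
by apply/funext => z; rewrite powR_inv1.
Qed.

(** [c = 4] is the unnormalized kernel of the operator. [c = 8] is the widened one that dominates it
    after multiplication by up to two powers of [|x - y|]. *)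
Definition heat_kernel n (c p : R) (x y : 'rV[R]_n) (sg : R) : R :=
  gauss (c * sg) x y / sg `^ p.

Lemma heat_kernel_ge0 n c p (x y : 'rV[R]_n) sg : 0 <= heat_kernel c p x y sg.
Proof. by rewrite divr_ge0 ?expR_ge0 ?powR_ge0. Qed.

Lemma measurable_heat_kernel d (S : measurableType d) n (b : S -> 'rV[R]_n)
    (f : S -> R) c p x : coord_measurable b -> measurable_fun setT f ->
  measurable_fun setT (fun z => heat_kernel c p x (b z) (f z)).
Proof.
move=> mb mf; apply: measurable_funM.
  by apply: measurable_gauss => //; exact: measurable_funM.
apply: measurable_inv_ge0 => [|z]; last exact: powR_ge0.
exact: (measurableT_comp (measurable_powR p)).
Qed.

Lemma heat_kernel_le n p (x y : 'rV[R]_n) sg : 0 < sg ->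
  heat_kernel 4 p x y sg <= heat_kernel 8 p x y sg.
Proof.
move=> sg0; rewrite ler_wpM2r ?invr_ge0 ?powR_ge0// le_gauss//; first by lra.
by rewrite ler_wpM2r ?(ltW sg0)//; lra.
Qed.

Lemma sqr_heat_kernel_le n p (x y : 'rV[R]_n) sg : 0 < sg ->
  enorm (y - x) ^+ 2 * heat_kernel 4 p x y sg <= 8 * sg * heat_kernel 8 p x y sg.
Proof.
move=> sg0; rewrite /heat_kernel !mulrA ler_wpM2r ?invr_ge0 ?powR_ge0// enormB.
have -> : 8 * sg = 2 * (4 * sg) by ring.
by apply: sqr_gauss_le; lra.
Qed.

Definition gauss_mass n : R := Num.sqrt (pi * 8) ^+ n.

Lemma gauss_mass_gt0 n : 0 < gauss_mass n.
Proof. by rewrite exprn_gt0// sqrtr_gt0 mulr_gt0// pi_gt0. Qed.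

(** The linear term integrates to zero, and the Gaussian has mass of order [sg^(n/2)], which leaves
    [sg^(n/2 - p) = sg^(-s-1)]. *)
Lemma iint_heat_kernel n s (x c : 'rV[R]_n) b sg : 0 < sg ->
  let p := n%:R / 2 + 1 + s in
  let F := fun y => (dotp c (y - x) * heat_kernel 4 p x y sg +
                     b * heat_kernel 8 p x y sg)%:E in
  slice_integrable F /\ iint F = (b * (gauss_mass n * sg `^ (- s - 1)))%:E.
Proof.
move=> sg0 p F.
have [s1 i1] := @iint_lin_gauss R n (4 * sg) c x ltac:(lra).
have [s2 i2] := @iint_gauss R n (8 * sg) x ltac:(lra).
have [t1 j1] := iintZl_slice (sg `^ p)^-1 s1.
have [t2 j2] := iintZl_slice (b / sg `^ p) s2.
have -> : F = (fun y => ((sg `^ p)^-1)%:E * (dotp c (y - x) * gauss (4 * sg) x y)%:E +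
    (b / sg `^ p)%:E * (gauss (8 * sg) x y)%:E)%E.
  by apply/funext => y; rewrite -!EFinM -EFinD /F /heat_kernel; congr EFin; ring.
split; first exact: slice_integrableD.
rewrite iintD_slice// j1 j2 i1 i2 mule0 add0e -EFinM; congr EFin.
rewrite (_ : pi * (8 * sg) = pi * 8 * sg); last by ring.
rewrite sqrtrM; last by rewrite mulr_ge0// pi_ge0.
rewrite exprMn -/(gauss_mass n).
have -> : Num.sqrt sg ^+ n = sg `^ (n%:R / 2).
  by rewrite -powR12_sqrt ?(ltW sg0)// -powR_mulrn ?powR_ge0// -powRrM mulrC.
rewrite (_ : - s - 1 = n%:R / 2 - p); last by rewrite /p; ring.
rewrite powRB; last by rewrite (gt_eqF sg0) implybT.
by ring.
Qed.

(** Serves both comparisons: [e = 1] for finiteness, [e = -1] for positivity. It is an identity, so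
    the sign of [e] is free, and [B] is fixed before [e], [c] and [P]. The integral of [P] may be
    infinite. *)
Lemma heat_integral n s (x : 'rV[R]_n) t k c1 be c2 :
  0 < k -> 0 <= c1 -> 0 <= c2 -> 0 < s -> s < be ->
  let p := n%:R / 2 + 1 + s in
  exists B, [/\ 0 <= B,
    B <= gauss_mass n * (c1 * (k `^ (be - s) / (be - s)) + c2 * (k `^ (- s) / s)) &
    forall e (c : R -> 'rV[R]_n) (P : R -> 'rV[R]_n -> R),
      jmeas (fun tau y => (P tau y)%:E) -> (forall tau y, 0 <= P tau y) ->
      (\int[mu]_(tau in `]-oo, t[) iint (fun y =>
         (dotp (c tau) (y - x) * heat_kernel 4 p x y (t - tau) +
          e * lag_bound k c1 be c2 (t - tau) * heat_kernel 8 p x y (t - tau) +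
          P tau y)%:E) =
       (e * B)%:E + \int[mu]_(tau in `]-oo, t[) iint (fun y => (P tau y)%:E))%E].
Proof.
move=> k0 c10 c20 s0 sbe p.
pose b tau := lag_bound k c1 be c2 (t - tau) * (t - tau) `^ (- s - 1).
have b0 tau : 0 <= b tau by rewrite mulr_ge0 ?powR_ge0 ?lag_bound_ge0.
have mt : measurable_fun setT (fun tau : R => t - tau) by exact: measurable_funB.
have mb : measurable_fun setT (fun tau => (b tau)%:E).
  apply/measurable_EFinP; apply: measurable_funM; first exact: measurable_lag_bound.
  exact: (measurableT_comp (measurable_powR _)).
have bnd := integral_lag_bound t k0 c10 c20 s0 sbe.
have intb : mu.-integrable `]-oo, t[ (fun tau => (b tau)%:E).
  apply/integrableP; split; first exact: (measurable_funTS mb).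
  apply: le_lt_trans (le_lt_trans bnd (ltry _)).
  by apply: le_integral_nomeas => tau _; rewrite gee0_abs// lee_fin b0.
have fin : (\int[mu]_(tau in `]-oo, t[) (b tau)%:E)%E \is a fin_num.
  by apply: integrable_fin_num => //; exact: measurable_itv.
pose B0 := fine (\int[mu]_(tau in `]-oo, t[) (b tau)%:E)%E.
have B0E : (\int[mu]_(tau in `]-oo, t[) (b tau)%:E)%E = B0%:E by rewrite fineK.
exists (gauss_mass n * B0); split.
- rewrite mulr_ge0 ?(ltW (gauss_mass_gt0 n))// fine_ge0//.
  by apply: integral_ge0 => tau _; rewrite lee_fin b0.
- rewrite ler_wpM2l ?(ltW (gauss_mass_gt0 n))//.
  by rewrite -lee_fin -B0E.
move=> e c P mP P0.
have cmP tau : cmeas (fun y => (P tau y)%:E) by exact: (jmeas_cmeas tau mP).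
transitivity (\int[mu]_(tau in `]-oo, t[) ((e * gauss_mass n)%:E * (b tau)%:E +
    iint (fun y => (P tau y)%:E)))%E.
  apply: eq_integral => tau; rewrite inE/= in_itv/= => taut.
  have sg0 : 0 < t - tau by rewrite subr_gt0.
  have [sF iF] := iint_heat_kernel s x (c tau) (e * lag_bound k c1 be c2 (t - tau)) sg0.
  transitivity (iint (fun y => (dotp (c tau) (y - x) * heat_kernel 4 p x y (t - tau) +
      e * lag_bound k c1 be c2 (t - tau) * heat_kernel 8 p x y (t - tau))%:E +
      (P tau y)%:E)%E).
    by apply: eq_iint => y; rewrite -EFinD.
  rewrite iintD_ge0r//; last by move=> y; rewrite lee_fin.
  by rewrite iF -EFinM; congr (_%:E + _)%E; rewrite /b; ring.
rewrite integralD_ge0r//.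
- by rewrite integralZl// B0E -EFinM; congr (_%:E + _)%E; ring.
- exact: integrableZl.
- apply: measurable_funTS; apply: jmeas_iint => // tau y; by rewrite lee_fin.
- by move=> tau _; apply: iint_ge0 => y; rewrite lee_fin.
Qed.

(** Allows [u] to be exchanged for its Borel representative. Only almost every time slice of [N] is
    null, so the exceptional times are discarded first and the space integrals are compared at the
    others. *)
Lemma eq_stint_off_null n (N : set ('rV[R]_n * R)) (F G : 'rV[R]_n -> R -> \bar R) D :
  borel_st N -> stint (fun y t => (\1_N (y, t))%:E) setT = 0%E ->
  (forall y t, ~ N (y, t) -> F y t = G y t) -> stint F D = stint G D.
Proof.
move=> bN N0 FG.
have mN := jmeas_indic bN.
pose H t := iint (fun y => (\1_N (y, t) : R)%:E).
have i0 t y : (0 <= (\1_N (y, t) : R)%:E)%E by rewrite lee_fin indicE.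
have mH : measurable_fun setT H by exact: (jmeas_iint mN).
have H0 t : (0 <= H t)%E by exact: iint_ge0.
have := (ae_eq_integral_abs mu measurableT mH).1.
have -> : (\int[mu]_t `|H t| = 0)%E.
  by rewrite -[RHS]N0; apply: eq_integral => t _; rewrite gee0_abs.
move=> /(_ erefl) [Z [mZ Z0 HZ]].
apply: (eq_integral_off_null mZ Z0) => t _ nZ.
apply: (eq_iint_off_null (h := fun y => (\1_N (y, t) : R)%:E)) => //.
- exact: (jmeas_cmeas t mN).
- by apply: contrapT => Ht; apply/nZ/HZ => /= /(_ I).
- move=> y [] h; apply: FG => Nyt; move: h; rewrite indicE mem_set//= => /eqP.
  by rewrite oner_eq0.
Qed.

Lemma lebn_eball n (x0 : 'rV[R]_n) r : 0 < r ->
  exists2 V, (2 * r / n.+1%:R) ^+ n <= V & lebn (eball x0 r) = V%:E.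
Proof.
move=> r0.
have up : (lebn (eball x0 r) <= (expR 1 * Num.sqrt (pi * r ^+ 2) ^+ n)%:E)%E.
  have r20 : 0 < r ^+ 2 by rewrite exprn_gt0.
  have [s1 i1] := iint_gauss x0 r20; have [s2 i2] := iintZl_slice (expR 1) s1.
  rewrite EFinM -i1 -i2; apply: le_iint => y; rewrite -EFinM lee_fin indicE.
  case: (boolP (y \in _)) => [/set_mem yB|_]; last by rewrite mulr_ge0 ?expR_ge0.
  rewrite /gauss -expRD -[leLHS]expR0 ler_expR mulNr subr_ge0 enormB.
  rewrite ler_pdivrMr// mul1r ler_pXn2r ?nnegrE ?enorm_ge0 ?(ltW r0)//.
  exact: ltW.
have lo : (((2 * r / n.+1%:R) ^+ n)%:E <= lebn (eball x0 r))%E.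
  pose a i := x0 ord0 i - r / n.+1%:R; pose b i := x0 ord0 i + r / n.+1%:R.
  have rn0 : 0 < r / n.+1%:R :> R by rewrite divr_gt0.
  have ab i : a i < b i by rewrite /a /b; move: (r / _) rn0 => q; lra.
  have [|_ iP] := @iint_prod R n (fun i => \1_(`[a i, b i]%classic)).
    by move=> i; exact: integrable_indic_itv.
  have <- : iint (fun y : 'rV_n => (\prod_i (\1_(`[a i, b i]%classic) (y ord0 i) : R))%:E) =
      ((2 * r / n.+1%:R) ^+ n)%:E.
    rewrite iP; congr EFin; rewrite (eq_bigr (fun=> 2 * r / n.+1%:R)).
      by rewrite prodr_const card_ord.
    move=> i _; rewrite integral_indic//= setIT lebesgue_measure_itv/= lte_fin ab -EFinB/=.
    by rewrite /a /b; ring.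
  apply: le_iint => y; rewrite lee_fin.
  have [yB|nB] := pselect (forall i, `[a i, b i]%classic (y ord0 i)); last first.
    have [i ni] : exists i, ~ `[a i, b i]%classic (y ord0 i) by exact/existsNP.
    by rewrite (bigD1 i)//= {1}indicE memNset// mul0r indicE.
  rewrite big1 => [|i _]; last by rewrite indicE mem_set.
  rewrite indicE mem_set// /eball/=.
  apply: le_lt_trans (enorm_le_sum _) _.
  apply: (@le_lt_trans _ _ (\sum_(i < n) r / n.+1%:R)).
    apply: ler_sum => i _; rewrite !mxE ler_distl.
    by have := yB i; rewrite /= in_itv.
  rewrite sumr_const card_ord -[_ *+ n]mulr_natr -mulrA gtr_pMr//.
  by rewrite mulrC ltr_pdivrMr// mul1r ltr_nat.
have fin : lebn (eball x0 r) \is a fin_num.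
  rewrite ge0_fin_numE; first exact: le_lt_trans up (ltry _).
  by apply: iint_ge0 => y; rewrite lee_fin indicE.
by exists (fine (lebn (eball x0 r))); rewrite ?fineK// -lee_fin fineK.
Qed.

End heat_kernel.

(** * Finiteness and positivity of the operator at the maximum *)

Section comparison.
Context {R : realType}.
Notation mu := (@lebesgue_measure R).

(** The integral in [frac_heat] before [fine] is applied, so that infinite values stay visible. *)
Definition heat_int n (s : R) (u : 'rV[R]_n -> R -> R) (x : 'rV[R]_n) (t : R) : \bar R :=
  (\int[mu]_(tau in `]-oo, t[)
     iint (fun y => ((u x t - u y tau) / (t - tau) `^ (n%:R / 2 + 1 + s)
                      * expR (- (enorm (x - y) ^+ 2) / (4 * (t - tau))))%:E))%E.

Lemma powR_le1D (z q : R) : 0 <= z -> 0 < q <= 1 -> z `^ q <= 1 + z.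
Proof.
move=> z0 /andP[q0 q1]; case: (leP z 1) => z1.
  apply: (@le_trans _ _ (1 `^ q)); last by rewrite powR1; lra.
  by rewrite ge0_ler_powR ?nnegrE ?(ltW q0).
by apply: le_trans (ler1_powR _ q1) _; lra.
Qed.

(** Parabolic interpolation: with [z = |y - x|^2 / sg], the power is [sg^(ga/2) * z^(ga/2)], and
    [z^(ga/2) <= 1 + z]. The constant is [9 = 1 + 8], from [heat_kernel_le] and
    [sqr_heat_kernel_le]. *)
Let mixed_power_le n p (x y : 'rV[R]_n) sg ga : 0 < sg -> 0 < ga <= 2 ->
  enorm (y - x) `^ ga * heat_kernel 4 p x y sg <=
  9 * sg `^ (ga / 2) * heat_kernel 8 p x y sg.
Proof.
move=> sg0 /andP[ga0 ga2].
have k0 := heat_kernel_ge0 4 p x y sg.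
have k48 := heat_kernel_le p x y sg0.
have sq := sqr_heat_kernel_le p x y sg0.
move: (heat_kernel 4 p x y sg) (heat_kernel 8 p x y sg) k0 k48 sq => k4 k8 k0 k48 sq.
pose z := enorm (y - x) ^+ 2 / sg.
have z0 : 0 <= z by rewrite divr_ge0 ?sqr_ge0 ?(ltW sg0).
have -> : enorm (y - x) `^ ga = sg `^ (ga / 2) * z `^ (ga / 2).
  rewrite -powRM ?(ltW sg0)// /z mulrC divfK ?gt_eqF//.
  by rewrite -powR_mulrn ?enorm_ge0// -powRrM; congr (_ `^ _); field.
have hz : z `^ (ga / 2) <= 1 + z.
  by apply: powR_le1D => //; apply/andP; split; lra.
have s0 := powR_ge0 sg (ga / 2).
rewrite -mulrA [X in _ <= X](_ : _ = sg `^ (ga / 2) * (9 * k8)); last by ring.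
rewrite ler_wpM2l//; apply: (@le_trans _ _ ((1 + z) * k4)); first by rewrite ler_wpM2r.
rewrite mulrDl mul1r.
have : z * k4 <= 8 * k8.
  by rewrite /z mulrAC ler_pdivrMr// (_ : 8 * k8 * sg = 8 * sg * k8)//; ring.
lra.
Qed.

(** Close to [(x, t)] the Taylor bound applies; elsewhere [u y tau] is charged to the weight of
    [calL] at time [t + 2]. At lags up to [k] the linear term is kept for all [y], also far from
    [x], because only its integral over the whole space vanishes. *)
Let upper_pointwise n s (u : 'rV[R]_n -> R -> R) x t :
  0 < s -> forall c C ga d, 0 <= C -> 2 * s < ga <= 2 -> 0 < d ->
  (forall y tau, enorm (y - x) < d -> 0 < t - tau <= d ->
      u x t - u y tau <= dotp c (y - x) +
        C * (enorm (y - x) `^ ga + (t - tau) `^ (ga / 2))) ->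
  let p := n%:R / 2 + 1 + s in
  exists k c1 c2 Cw, [/\ 0 < k, 0 <= c1, 0 <= c2, 0 <= Cw &
    forall tau y, tau < t ->
    (u x t - u y tau) / (t - tau) `^ p * expR (- (enorm (x - y) ^+ 2) / (4 * (t - tau))) <=
    dotp (if t - tau <= k then c else 0) (y - x) * heat_kernel 4 p x y (t - tau) +
    1 * lag_bound k c1 (ga / 2) c2 (t - tau) * heat_kernel 8 p x y (t - tau) +
    Cw * (`|u y tau| * expR (- (enorm y ^+ 2) / (4 * (t + 2 - tau)))
                / (1 + (t + 2 - tau) `^ p))].
Proof.
move=> s0 c C ga d C0 /andP[ga0 ga2] d0 tay p.
have p0 : 0 < p.
  by have : (0 : R) <= n%:R / 2 by []; rewrite /p; lra.
pose k := Num.min d 1.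
have k0 : 0 < k by rewrite lt_min d0 ltr01.
have kd : k <= d by rewrite ge_min lexx.
have k1 : k <= 1 by rewrite ge_min lexx orbT.
have [Cw Cw0 hw] := heat_le_weight x p0 (introT andP (conj k0 k1)) d0.
pose cs := \sum_i `|c ord0 i|.
have cs0 : 0 <= cs by rewrite sumr_ge0.
pose C2 := `|u x t| / d ^+ 2 + cs / d.
have C20 : 0 <= C2 by rewrite addr_ge0 ?divr_ge0 ?sqr_ge0 ?(ltW d0).
(* [10 = 9 + 1] covers the space and the time power of the Taylor remainder; [8 * C2] covers the
   leftovers at distance at least [d]. *)
exists k, (10 * C + 8 * C2), `|u x t|, Cw; split => //; first by lra.
move=> tau y taut; set sg := t - tau.
have sg0 : 0 < sg by rewrite subr_gt0.
rewrite (_ : t + 2 - tau = sg + 2); last by rewrite /sg; ring.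
rewrite (_ : _ * expR _ = (u x t - u y tau) * heat_kernel 4 p x y sg); last first.
  by rewrite /heat_kernel /gauss; ring.
set Wt := Cw * _.
have hw' := hw y sg sg0; rewrite -/(heat_kernel 4 p x y sg) in hw'.
have W0 : 0 <= Wt.
  by rewrite /Wt mulr_ge0// divr_ge0 ?mulr_ge0 ?expR_ge0 ?addr_ge0 ?powR_ge0.
have uW : k < sg \/ d <= enorm (y - x) -> `|u y tau| * heat_kernel 4 p x y sg <= Wt.
  move=> /hw' h; rewrite /Wt -[X in Cw * X]mulrA [leRHS]mulrCA.
  by rewrite ler_wpM2l.
have q0 := heat_kernel_ge0 4 p x y sg.
have q8 := heat_kernel_ge0 8 p x y sg.
have q48 := heat_kernel_le p x y sg0.
have sq := sqr_heat_kernel_le p x y sg0.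
have mx := @mixed_power_le n p x y sg ga sg0 ltac:(apply/andP; split; lra).
have e0 := enorm_ge0 (y - x).
have dl := dotp_le c (y - x); rewrite -/cs in dl.
have ty := tay y tau.
move: Wt W0 (heat_kernel 4 p x y sg) (heat_kernel 8 p x y sg) uW q0 q8 q48 sq mx
  {hw'} => Wt W0 k4 k8 uW q0 q8 q48 sq mx.
rewrite /lag_bound mul1r; case: ifPn => [sgk|]; last first.
  rewrite -ltNge => ksg; have {}uW := uW (or_introl ksg).
  rewrite {1}/dotp big1 ?mul0r ?add0r => [|i _]; last by rewrite mxE mul0r.
  have h1 : (u x t - u y tau) * k4 <= (`|u x t| + `|u y tau|) * k4.
    by rewrite ler_wpM2r//; have := ler_norm (u x t); have := ler_norm (- u y tau); rewrite normrN; lra.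
  have h2 : `|u x t| * k4 <= `|u x t| * k8 by rewrite ler_wpM2l.
  by lra.
set be := ga / 2 in mx ty *.
have sb : 0 <= sg `^ be by exact: powR_ge0.
have sgb : sg <= sg `^ be.
  by apply: ger1_powR; [apply/andP; split; lra|rewrite /be; lra].
have [hd|dh] := ltP (enorm (y - x)) d.
  have {}ty := ty hd ltac:(apply/andP; split; [exact: sg0|exact: le_trans kd]).
  have h1 : (u x t - u y tau) * k4 <=
      (dotp c (y - x) + C * (enorm (y - x) `^ ga + sg `^ be)) * k4 by rewrite ler_wpM2r.
  have h2 : C * (enorm (y - x) `^ ga * k4) <= C * (9 * sg `^ be * k8) by rewrite ler_wpM2l.
  have h3 : C * sg `^ be * k4 <= C * sg `^ be * k8 by rewrite ler_wpM2l// mulr_ge0.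
  have h4 : 0 <= C2 * sg `^ be * k8 by rewrite !mulr_ge0.
  by lra.
have {}uW := uW (or_intror dh).
have h1 : (u x t - u y tau) * k4 <= (`|u x t| + `|u y tau|) * k4.
  by rewrite ler_wpM2r//; have := ler_norm (u x t); have := ler_norm (- u y tau); rewrite normrN; lra.
(* At distance at least [d], a constant and a linear function are dominated by a quadratic one,
   which the wider Gaussian absorbs. *)
have h2 : `|u x t| + cs * enorm (y - x) <= C2 * enorm (y - x) ^+ 2.
  rewrite /C2 mulrDl; apply: lerD.
    rewrite mulrAC ler_pdivlMr ?exprn_gt0// ler_wpM2l//.
    by rewrite ler_pXn2r ?nnegrE ?(ltW d0).
  rewrite mulrAC ler_pdivlMr// -mulrA ler_wpM2l// expr2 ler_wpM2l//.
have h3 : - dotp c (y - x) <= cs * enorm (y - x).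
  by apply: le_trans dl; rewrite -normrN ler_norm.
have h4 : (`|u x t| - dotp c (y - x)) * k4 <= C2 * enorm (y - x) ^+ 2 * k4.
  by rewrite ler_wpM2r//; lra.
have h5 : C2 * (enorm (y - x) ^+ 2 * k4) <= C2 * (8 * sg * k8) by rewrite ler_wpM2l.
have h6 : C2 * k8 * sg <= C2 * k8 * sg `^ be by rewrite ler_wpM2l// mulr_ge0.
have h7 : 0 <= C * sg `^ be * k8 by rewrite !mulr_ge0.
by lra.
Qed.

(* Finiteness matters: [fine] maps an infinite integral to [0], for which the
   differential inequality would be void. *)
Lemma heat_int_lty n (s eps : R) (Om : set 'rV[R]_n) u x t :
  0 < s < 1 -> 0 < eps < 1 -> open Om -> parabolic_holder_loc (s + eps / 2) Om u ->
  calL s u -> Om x -> (heat_int s u x t < +oo)%E.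
Proof.
move=> s01 eps01 oOm hu [[[g [mg [N [bN [N0 uN]]]]] _] Lu] Ox.
have s0 : 0 < s by case/andP: s01.
have [c [C [ga [d [C0 ga02 d0 tay]]]]] := parabolic_taylor t s01 eps01 oOm hu Ox.
have sga : s < ga / 2 by case/andP: ga02; lra.
have [k [c1 [c2 [Cw [k0 c10 c20 Cw0 up]]]]] := upper_pointwise s0 C0 ga02 d0 tay.
set p := n%:R / 2 + 1 + s in up.
pose w (f : 'rV[R]_n -> R -> R) tau y :=
  `|f y tau| * expR (- (enorm y ^+ 2) / (4 * (t + 2 - tau))) / (1 + (t + 2 - tau) `^ p).
have w0 f tau y : 0 <= w f tau y.
  by rewrite divr_ge0 ?mulr_ge0 ?expR_ge0 ?addr_ge0 ?powR_ge0.
have mw : jmeas (fun tau y => (w g tau y)%:E).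
  move=> d' S a b ma mb; apply/measurable_EFinP.
  have mt : measurable_fun setT (fun z => t + 2 - a z) by exact: measurable_funB.
  apply: measurable_funM.
    apply: measurable_funM.
      apply: measurableT_comp => //.
      by have /measurable_EFinP := jmeas_borel mg ma mb.
    have := @measurable_gauss R _ S n b (fun z => 4 * (t + 2 - a z)) 0 mb
      (measurable_funM (measurable_cst _) mt).
    by under eq_fun do rewrite /gauss sub0r enormN.
  apply: measurable_inv_ge0 => [|z]; last by rewrite addr_ge0 ?powR_ge0.
  by apply: measurable_funD => //; exact: (measurableT_comp (measurable_powR p)).
have mCw : jmeas (fun tau y => (Cw * w g tau y)%:E).
  move=> d' S a b ma mb; apply/measurable_EFinP; apply: measurable_funM => //.
  by have /measurable_EFinP := mw _ _ _ _ ma mb.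
have [B [_ _ hB]] := heat_integral x t k0 c10 c20 s0 sga.
pose F (f : 'rV[R]_n -> R -> R) y tau : \bar R :=
  (dotp (if t - tau <= k then c else 0) (y - x) * heat_kernel 4 p x y (t - tau) +
    1 * lag_bound k c1 (ga / 2) c2 (t - tau) * heat_kernel 8 p x y (t - tau) +
    Cw * w f tau y)%:E.
(* The comparison is made for [u] itself, which may fail to be Borel; only the majorant is then
   rewritten with [g]. *)
apply: (@le_lt_trans _ _ (stint (F u) `]-oo, t[)).
  apply: le_integral_nomeas => tau; rewrite /= in_itv/= => taut.
  by apply: le_iint => y; rewrite lee_fin; exact: up.
have ug y tau : ~ N (y, tau) -> u y tau = g y tau.
  by move=> nN; apply: contrapT => /uN.
rewrite (@eq_stint_off_null _ n N (F u) (F g))//; last first.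
  by move=> y tau /ug e; rewrite /F /w e.
rewrite /stint /F hB//; last by move=> tau y; rewrite mulr_ge0.
rewrite lte_add_pinfty ?ltry//.
have ge0g (tau : R) : (0 <= iint (fun y => (w g tau y)%:E))%E.
  by apply: iint_ge0 => y; rewrite lee_fin.
have mig : measurable_fun setT (fun tau => iint (fun y => (w g tau y)%:E)).
  by apply: (jmeas_iint mw) => tau y; rewrite lee_fin.
have fing : (\int[mu]_(tau in `]-oo, t[) iint (fun y => (w g tau y)%:E) < +oo)%E.
  apply: le_lt_trans (Lu (t + 2)).
  rewrite -/p (@eq_stint_off_null _ n N _ (fun y tau => (w g tau y)%:E))//; last first.
    by move=> y tau /ug e; rewrite /w e.
  apply: ge0_subset_integral_nomeas => [tau|tau _]; last exact: ge0g.
  by rewrite /= !in_itv/= => h; apply: lt_trans h _; lra.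
rewrite (_ : (\int[mu]_(tau in _) _)%E =
  (Cw%:E * \int[mu]_(tau in `]-oo, t[) iint (fun y => (w g tau y)%:E))%E).
  by rewrite lte_mul_pinfty// ?lee_fin.
rewrite -ge0_integralZl//; last exact: (measurable_funTS mig).
apply: eq_integral => tau _; rewrite -iintZl//.
- exact: (jmeas_cmeas tau mw).
- by move=> y; rewrite lee_fin.
Qed.

(** Only lags between [r^2] and [2 r^2] and points [y] of [B_r(x0)] outside [Om] are kept. There
    [|x - y|^2 <= 4 r^2 <= 4 sg], so the Gaussian is at least [exp(-1)], and the pole contributes at
    least [(2 r^2)^-p]; the last factor [r^2] is the length of the time window. *)
Lemma exterior_mass n p (Om : set 'rV[R]_n) x x0 t r a c : open Om -> 0 < r ->
  0 <= p -> 0 <= a -> 0 <= c -> c < ext_ratio Om x0 r -> enorm (x - x0) ^+ 2 < r ^+ 2 ->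
  ((a * (expR (- 1) / (2 * r ^+ 2) `^ p) * (c * (2 * r / n.+1%:R) ^+ n) * r ^+ 2)%:E <=
   \int[mu]_(tau in `]-oo, t[)
     iint (fun y => (a * \1_(~` Om) y * heat_kernel 4 p x y (t - tau))%:E))%E.
Proof.
move=> oOm r0 p0 a0 c0 cr xx0.
have rho0 : 0 < r ^+ 2 by rewrite exprn_gt0.
have [V Vlo VE] := lebn_eball x0 r0.
have V0 : 0 < V by apply: lt_le_trans Vlo; rewrite exprn_gt0// divr_gt0// mulr_gt0.
pose K0 := expR (- 1) / (2 * r ^+ 2) `^ p.
have K00 : 0 <= K0 by rewrite divr_ge0 ?expR_ge0 ?powR_ge0.
set BO := eball x0 r `&` ~` Om.
have mBO : cmeas (fun y => (\1_BO y : R)%:E).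
  move=> d S b mb; apply/measurable_EFinP.
  rewrite (_ : (fun y => _) = (fun z => (if enorm (b z - x0) < r then 1 else 0) * (\1_(~` Om) (b z) : R))).
    apply: measurable_funM; last by have /measurable_EFinP := cmeas_indic_open oOm mb.
    apply: measurable_fun_ifT => //; apply: measurable_fun_ltr => //.
    under eq_fun do rewrite enormB.
    exact/measurable_enorm/coord_measurableB.
  apply/funext => z; rewrite /BO indicI/=; congr (_ * _); rewrite indicE.
  case: ifPn => h; first by rewrite mem_set.
  by rewrite memNset//= => hz; move: h; rewrite /eball/= in hz; rewrite hz.
have i0 y : (0 <= (\1_BO y : R)%:E)%E by rewrite lee_fin indicE.
have LleV : (lebn BO <= V%:E)%E.
  rewrite -VE; apply: le_iint => y; rewrite lee_fin !indicE ler_nat.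
  by case: (boolP (y \in BO)) => // /set_mem[yB _]; rewrite mem_set.
have Lfin : lebn BO \is a fin_num.
  rewrite ge0_fin_numE; first exact: le_lt_trans LleV (ltry _).
  exact: iint_ge0.
have cV : c * V <= fine (lebn BO).
  by move: cr; rewrite /ext_ratio VE/= ltr_pdivlMr// => /ltW.
apply: (@le_trans _ _ (\int[mu]_(tau in `[(t - 2 * r ^+ 2)%R, (t - r ^+ 2)%R])
    (cst (a * K0 * fine (lebn BO))%:E tau))%E).
  rewrite integral_cst//= lebesgue_measure_itv/= lte_fin.
  rewrite ifT; last by rewrite ltrD2l ltrN2; lra.
  rewrite -EFinB -EFinM lee_fin (_ : t - r ^+ 2 - (t - 2 * r ^+ 2) = r ^+ 2); last by ring.
  rewrite ler_wpM2r ?(ltW rho0)// -/K0 ler_wpM2l//; first exact: mulr_ge0.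
  by apply: le_trans cV; rewrite ler_wpM2l.
apply: (@le_trans _ _ (\int[mu]_(tau in `[(t - 2 * r ^+ 2)%R, (t - r ^+ 2)%R])
     iint (fun y => (a * \1_(~` Om) y * heat_kernel 4 p x y (t - tau))%:E))%E); last first.
  apply: ge0_subset_integral_nomeas => [tau|tau _].
    by rewrite /= !in_itv/= => /andP[_ h]; apply: le_lt_trans h _; lra.
  apply: iint_ge0 => y; rewrite lee_fin; apply: mulr_ge0 (heat_kernel_ge0 _ _ _ _ _).
  exact: mulr_ge0.
apply: le_integral_nomeas => tau; rewrite /= in_itv/= => /andP[h1 h2].
have {h1} h1 : t - tau <= 2 * r ^+ 2 by lra.
have {h2} h2 : r ^+ 2 <= t - tau by lra.
move: (t - tau) h1 h2 => sg h1 h2.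
have sg0 : 0 < sg by exact: lt_le_trans h2.
rewrite EFinM fineK// -[lebn BO]/(iint _) -iintZl//; last exact: mulr_ge0.
apply: le_iint => y; rewrite -EFinM lee_fin.
rewrite indicE; case: (boolP (y \in BO)) => [/set_mem[yB yO]|_]; last first.
  rewrite mulr0; apply: mulr_ge0 (heat_kernel_ge0 _ _ _ _ _); exact: mulr_ge0.
rewrite indicE mem_set// !mulr1 ler_wpM2l// /K0 /heat_kernel.
rewrite ler_pM ?expR_ge0 ?invr_ge0 ?powR_ge0//; last first.
  rewrite lef_pV2 ?posrE ?powR_gt0//; last by apply: mulr_gt0.

  by rewrite ge0_ler_powR ?nnegrE//; lra.
rewrite /gauss ler_expR mulNr lerN2 ler_pdivrMr ?mul1r; last by lra.
have yB2 : enorm (y - x0) ^+ 2 < r ^+ 2.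
  by rewrite ltr_pXn2r ?nnegrE ?enorm_ge0 ?(ltW r0).
apply: (@le_trans _ _ (2 * enorm (x - x0) ^+ 2 + 2 * enorm (y - x0) ^+ 2)); last by lra.
rewrite !enorm_sqr !mulr_sumr -big_split/=; apply: ler_sum => i _.
rewrite !mxE; have := sqr_ge0 (x ord0 i + y ord0 i - 2 * x0 ord0 i).
by rewrite !expr2; lra.
Qed.

(** The vector in [dotp] is the space gradient of [ep * bump] at [(x, t)]. The constant is
    [11 = 8 + 3]: 8 from the quadratic term through the wider Gaussian, 3 from the increment in
    time. Beyond lag [rho] the inequality [u x t > A - ep] is enough. *)
Let lower_pointwise n p (Om : set 'rV[R]_n) (u : 'rV[R]_n -> R -> R) A ep x0 t0 rho x t :
  (forall x t, Om x -> u x t <= A) -> (forall x t, ~ Om x -> u x t <= 0) ->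
  0 < ep -> ep <= A / 2 -> 0 < rho ->
  0 < bump x0 t0 rho x t -> A < u x t + ep * bump x0 t0 rho x t ->
  (forall y tau, Om y -> u y tau + ep * bump x0 t0 rho y tau <=
                          u x t + ep * bump x0 t0 rho x t) ->
  forall tau y, tau < t ->
  dotp (if t - tau <= rho then ep *: ((- 2 / rho) *: (x - x0)) else 0) (y - x) *
    heat_kernel 4 p x y (t - tau) +
  -1 * lag_bound rho (11 * ep / rho) 1 ep (t - tau) * heat_kernel 8 p x y (t - tau) +
  A / 2 * \1_(~` Om) y * heat_kernel 4 p x y (t - tau) <=
  (u x t - u y tau) / (t - tau) `^ p * expR (- (enorm (x - y) ^+ 2) / (4 * (t - tau))).
Proof.
move=> uA u0 ep0 epA rho0 b0 wA wmax tau y taut; set sg := t - tau.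
have sg0 : 0 < sg by rewrite subr_gt0.
rewrite (_ : _ * expR _ = (u x t - u y tau) * heat_kernel 4 p x y sg); last first.
  by rewrite /heat_kernel /gauss; ring.
have q0 := heat_kernel_ge0 4 p x y sg.
have q48 := heat_kernel_le p x y sg0.
have sq := sqr_heat_kernel_le p x y sg0.
move: (heat_kernel 4 p x y sg) (heat_kernel 8 p x y sg) q0 q48 sq => k4 k8 q0 q48 sq.
have p1 y' : 0 <= enorm (y' - x0) ^+ 2 / rho by rewrite divr_ge0 ?sqr_ge0 ?(ltW rho0).
have p2 tau' : 0 <= (tau' - t0) ^+ 2 / rho ^+ 2 by rewrite divr_ge0 ?sqr_ge0.
have bump1 y' tau' : bump x0 t0 rho y' tau' <= 1.
  by rewrite /bump; have := p1 y'; have := p2 tau'; lra.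
have epb : ep * bump x0 t0 rho x t <= ep by rewrite ler_piMr ?(ltW ep0).
have epb0 : 0 <= ep * bump x0 t0 rho x t by rewrite mulr_ge0// ltW.
have indO : Om y -> \1_(~` Om) y = 0 :> R.
  by move=> Oy; rewrite indicE memNset//= => /(_ Oy).
have indN : ~ Om y -> \1_(~` Om) y = 1 :> R by move=> nO; rewrite indicE mem_set.
rewrite /lag_bound; case: ifPn => [sgr|_]; last first.
  rewrite {1}/dotp big1 ?mul0r ?add0r => [|i _]; last by rewrite mxE mul0r.
  have h : - ep + A / 2 * \1_(~` Om) y <= u x t - u y tau.
    have [Oy|nO] := pselect (Om y).
      by rewrite (indO Oy) mulr0 addr0; have := uA y tau Oy; lra.
    by rewrite (indN nO); have := u0 y tau nO; lra.
  have := ler_wpM2r q0 h; have : ep * k4 <= ep * k8 by rewrite ler_wpM2l// ltW.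
  by lra.
rewrite powRr1 ?(ltW sg0)//.
have tt0 : `|t - t0| <= rho.
  have : (t - t0) ^+ 2 / rho ^+ 2 <= 1 by move: b0; rewrite /bump; have := p1 x; lra.
  rewrite ler_pdivrMr ?exprn_gt0// mul1r => h.
  by rewrite -(ler_pXn2r (n := 2)) ?nnegrE ?(ltW rho0)// real_normK ?num_real.
have dE : dotp (ep *: ((- 2 / rho) *: (x - x0))) (y - x) =
    ep * (- 2 / rho * dotp (x - x0) (y - x)).
  by rewrite /dotp !mulr_sumr; apply: eq_bigr => i _; rewrite !mxE; ring.
have eE : enorm (y - x0) ^+ 2 =
    enorm (x - x0) ^+ 2 + 2 * dotp (x - x0) (y - x) + enorm (y - x) ^+ 2.
  rewrite !enorm_sqr /dotp mulr_sumr -!big_split/=; apply: eq_bigr => i _.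
  by rewrite !mxE; ring.
(* Both [|t - t0|] and the lag [sg] are at most [rho], so [- 2 (t - t0) sg + sg^2] is at most
   [3 * rho * sg]. *)
have tE : (tau - t0) ^+ 2 / rho ^+ 2 <= (t - t0) ^+ 2 / rho ^+ 2 + 3 * sg / rho.
  rewrite (_ : 3 * sg / rho = 3 * sg * rho / rho ^+ 2); last by field; rewrite gt_eqF.
  rewrite -mulrDl ler_wpM2r ?invr_ge0 ?sqr_ge0//.
  have -> : tau - t0 = (t - t0) - sg by rewrite /sg; ring.
  move: tt0 => /ler_normlP[]; nra.
have bE : dotp (ep *: ((- 2 / rho) *: (x - x0))) (y - x)
    - ep * (enorm (y - x) ^+ 2 / rho) - ep * (3 * sg / rho) <=
    ep * (bump x0 t0 rho y tau - bump x0 t0 rho x t).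
  rewrite dE -!mulrBr ler_wpM2l ?(ltW ep0)// /bump eE !mulrDl.
  have -> : - 2 / rho * dotp (x - x0) (y - x) = - (2 * dotp (x - x0) (y - x) / rho) by ring.
  by lra.
have h : dotp (ep *: ((- 2 / rho) *: (x - x0))) (y - x)
    - ep * (enorm (y - x) ^+ 2 / rho) - ep * (3 * sg / rho) + A / 2 * \1_(~` Om) y
    <= u x t - u y tau.
  apply: le_trans (lerD bE (lexx _)) _.
  have [Oy|nO] := pselect (Om y).
    by rewrite (indO Oy) mulr0 addr0; have := wmax y tau Oy; lra.
  rewrite (indN nO); have := u0 y tau nO.
  have : ep * bump x0 t0 rho y tau <= ep by rewrite ler_piMr ?(ltW ep0).
  by lra.
have := ler_wpM2r q0 h.
have er : 0 <= ep / rho by rewrite divr_ge0 ?ltW.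
have h1 := ler_wpM2l er sq.
have h2 : ep / rho * (3 * sg) * k4 <= ep / rho * (3 * sg) * k8.
  by rewrite ler_wpM2l// mulr_ge0//; lra.
rewrite (_ : ep * (enorm (y - x) ^+ 2 / rho) = ep / rho * enorm (y - x) ^+ 2); last by ring.
rewrite (_ : ep * (3 * sg / rho) = ep / rho * (3 * sg)); last by ring.
rewrite (_ : 11 * ep / rho * sg = ep / rho * (11 * sg)); last by ring.
move: (ep / rho) h1 h2 => q h1 h2.
by lra.
Qed.

(** The quantifier order is the point: [ep] precedes [x0], [t0], [r] and the maximum point, which is
    possible because gain and loss are both multiples of [rho^-s]. *)
Lemma heat_int_gt0 n s (Om : set 'rV[R]_n) (u : 'rV[R]_n -> R -> R) A Cb :
  0 < s < 1 -> open Om -> 0 < A -> 0 < Cb ->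
  (forall x t, Om x -> u x t <= A) -> (forall x t, ~ Om x -> u x t <= 0) ->
  exists ep, [/\ 0 < ep, ep <= A / 2 &
    forall x0 t0 r x t, 0 < r -> Cb / 2 < ext_ratio Om x0 r ->
    let rho := r ^+ 2 in
    0 < bump x0 t0 rho x t -> A < u x t + ep * bump x0 t0 rho x t ->
    (forall y tau, Om y -> u y tau + ep * bump x0 t0 rho y tau <=
                            u x t + ep * bump x0 t0 rho x t) ->
    (0 < heat_int s u x t)%E].
Proof.
move=> /andP[s0 s1] oOm A0 Cb0 uA u0.
pose p := n%:R / 2 + 1 + s : R.
have n20 : (0 : R) <= n%:R / 2 by [].
have p0 : 0 <= p by rewrite /p; lra.
(* [kap] is the bound of [exterior_mass] and [D] that of [heat_integral] with [be = 1], both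
   stripped of the powers of [r]; in [D] the factor [ep] is removed too. *)
pose kap := A / 2 * (expR (- 1) / 2 `^ p) * (Cb / 2 * (2 / n.+1%:R) ^+ n).
have kap0 : 0 < kap.
  by rewrite /kap !mulr_gt0 ?invr_gt0 ?expR_gt0 ?powR_gt0 ?exprn_gt0 ?divr_gt0.
pose D := gauss_mass n * (11 / (1 - s) + 1 / s) : R.
have D0 : 0 < D.
  by rewrite mulr_gt0 ?gauss_mass_gt0// addr_gt0// divr_gt0// subr_gt0.
exists (Num.min (A / 2) (kap / (2 * D))); set ep := Num.min _ _.
have ep0 : 0 < ep by rewrite lt_min !divr_gt0// mulr_gt0.
have epA : ep <= A / 2 by rewrite ge_min lexx.
have epD : ep * D <= kap / 2.
  have : ep <= kap / (2 * D) by rewrite ge_min lexx orbT.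
  have D20 : 0 < 2 * D by lra.
  by rewrite (ler_pdivlMr _ _ D20) => h; lra.
split=> // x0 t0 r x t r0 cr rho b0 wA wmax.
have rho0 : 0 < rho by rewrite exprn_gt0.
have c10 : 0 <= 11 * ep / rho.
  by apply: divr_ge0 (ltW rho0); apply: mulr_ge0 => //; exact: ltW.
have [B [B0 Ble hB]] := heat_integral x t rho0 c10 (ltW ep0) s0 s1.
pose P tau y : R := A / 2 * \1_(~` Om) y * heat_kernel 4 p x y (t - tau).
have P0 tau y : 0 <= P tau y.
  apply: mulr_ge0 (heat_kernel_ge0 _ _ _ _ _); apply: mulr_ge0 => //.
  by rewrite divr_ge0 ?(ltW A0).
have mP : jmeas (fun tau y => (P tau y)%:E).
  move=> d S a b ma mb; apply/measurable_EFinP; apply: measurable_funM.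
    apply: measurable_funM => //.
    by have /measurable_EFinP := cmeas_indic_open oOm mb.
  by apply: measurable_heat_kernel => //; exact: measurable_funB.
have xx0 : enorm (x - x0) ^+ 2 < rho.
  have : 0 <= (t - t0) ^+ 2 / rho ^+ 2 by rewrite divr_ge0 ?sqr_ge0.
  move: b0; rewrite /bump => h1 h2.
  have : enorm (x - x0) ^+ 2 / rho < 1 by lra.
  by rewrite ltr_pdivrMr// mul1r.
have low : (((-1) * B)%:E + \int[mu]_(tau in `]-oo, t[) iint (fun y => (P tau y)%:E)
    <= heat_int s u x t)%E.
  rewrite -(hB (-1) (fun tau => if t - tau <= rho then ep *: ((- 2 / rho) *: (x - x0)) else 0))//.
  apply: le_integral_nomeas => tau; rewrite /= in_itv/= => taut.
  apply: le_iint => y; rewrite lee_fin.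
  exact: (lower_pointwise p uA u0 ep0 epA rho0 b0 wA wmax).
apply: lt_le_trans low.
have mass := exterior_mass (x := x) t oOm r0 p0 (ltW (divr_gt0 A0 (ltr0Sn R 1)))
  (ltW (divr_gt0 Cb0 (ltr0Sn R 1))) cr xx0.
apply: lt_le_trans (leeD (lexx _) mass).
rewrite -EFinD lte_fin mulN1r addrC subr_gt0.
have rs0 : 0 < rho `^ (- s) by rewrite powR_gt0.
have rp : rho `^ (n%:R / 2) * rho / rho `^ p = rho `^ (- s).
  rewrite -[X in _ * X / _]powRr1 ?(ltW rho0)// -powRD; last by rewrite (gt_eqF rho0) implybT.
  rewrite -powRB; last by rewrite (gt_eqF rho0) implybT.
  by congr (_ `^ _); rewrite /p; ring.
have rn : r ^+ n = rho `^ (n%:R / 2).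
  rewrite /rho -[r ^+ 2]powR_mulrn ?(ltW r0)// -powRrM.
  by rewrite -powR_mulrn ?(ltW r0)//; congr (_ `^ _); field.
have -> : A / 2 * (expR (-1) / (2 * r ^+ 2) `^ p) * (Cb / 2 * (2 * r / n.+1%:R) ^+ n) * r ^+ 2
   = kap * rho `^ (- s).
  rewrite -rp -rn /kap -/rho (mulrAC 2 r) exprMn powRM ?(ltW rho0)// invfM.
  by ring.
have r1 : rho^-1 * rho `^ (1 - s) = rho `^ (- s).
  rewrite -powR_inv1 ?(ltW rho0)// -powRD; last by rewrite (gt_eqF rho0) implybT.
  by congr (_ `^ _); ring.
apply: (@le_lt_trans _ _ (ep * D * rho `^ (- s))).
  apply: le_trans Ble _; rewrite le_eqVlt; apply/orP; left; apply/eqP.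
  rewrite /D -[in RHS]r1.
  rewrite (_ : 11 * ep / rho * (rho `^ (1 - s) / (1 - s)) =
    11 * ep / (1 - s) * (rho^-1 * rho `^ (1 - s))); last by ring.
  rewrite r1; ring.
rewrite ltr_pM2r//; lra.
Qed.

End comparison.

Theorem theorem1p4 (R : realType) (n : nat) (s eps : R)
    (Om : set 'rV[R]_n) (u : 'rV[R]_n -> R -> R) :
  (0 < n)%N -> 0 < s < 1 -> 0 < eps < 1 ->
  open Om ->
  (exists Cbar : R, 0 < Cbar /\
     forall x, Om x -> exists l : R,
       ext_ratio Om x r @[r --> +oo] --> l /\ Cbar <= l) ->
  parabolic_holder_loc (s + eps / 2) Om u ->
  calL s u ->
  usc_up_to_boundary Om u ->
  (exists M : R, forall x t, Om x -> u x t <= M) ->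
  (forall x t, Om x -> 0 < u x t -> frac_heat s u x t <= 0) ->
  (forall x t, ~ Om x -> u x t <= 0) ->
  forall x t, Om x -> u x t <= 0.
Proof.
move=> _ s01 eps01 oOm [Cb [Cb0 hC]] hol hL usc [M uM] hheat u0 x1 t1 Ox1.
rewrite leNgt; apply/negP => upos.
pose U := [set a | exists x t, Om x /\ a = u x t].
have hsU : has_sup U.
  split; first by exists (u x1 t1), x1, t1.
  by exists M => _ [x [t [Ox ->]]]; exact: uM.
pose A := sup U.
have uA x t : Om x -> u x t <= A.
  by move=> Ox; apply: ub_le_sup; [exact: hsU.2|exists x, t].
have A0 : 0 < A by apply: lt_le_trans upos (uA _ _ Ox1).
have [ep [ep0 epA pos]] := heat_int_gt0 s01 oOm A0 Cb0 uA u0.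
have [_ [x0 [t0 [Ox0 ->]]] ux0] := sup_adherent ep0 hsU.
have [l [cvl Cl]] := hC x0 Ox0.
(* Halving the constant leaves strict room below the limit. The radius depends on [x0] with no
   control on its size. *)
have [r r0 cr] : exists2 r : R, 0 < r & Cb / 2 < ext_ratio Om x0 r.
  have cbl : Cb / 2 < l by apply: lt_le_trans Cl; lra.
  have /= near_l : \forall r \near +oo, Cb / 2 < ext_ratio Om x0 r.
    exact: (cvgr_gt l cvl _ cbl).
  have near_0 : \forall r \near +oo, (0 : R) < r by exact: nbhs_pinfty_gt.
  have [r [? ?]] := filter_ex (filterI near_l near_0).
  by exists r.
have rho0 : 0 < r ^+ 2 by rewrite exprn_gt0.
have [x [t [Ox b0 wA wmax]]] := penalized_max usc uA u0 ep0 epA rho0 Ox0 ux0.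
(* The differential inequality is only assumed where [u] is positive; here
   [u x t > A - ep >= A / 2]. *)
have ut0 : 0 < u x t.
  have b1 : bump x0 t0 (r ^+ 2) x t <= 1.
    rewrite /bump; have : 0 <= enorm (x - x0) ^+ 2 / r ^+ 2 by rewrite divr_ge0 ?sqr_ge0.
    have : 0 <= (t - t0) ^+ 2 / (r ^+ 2) ^+ 2 by rewrite divr_ge0 ?sqr_ge0.
    lra.
  have : ep * bump x0 t0 (r ^+ 2) x t <= ep by rewrite ler_piMr ?(ltW ep0).
  lra.
have Ipos := pos x0 t0 r x t r0 cr b0 wA wmax.
have Ifin := heat_int_lty t s01 eps01 oOm hol hL Ox.
have := hheat x t Ox ut0; rewrite leNgt => /negP; apply.
by rewrite mulr_gt0 ?Cns_gt0// fine_gt0// Ipos Ifin.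
Qed.
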